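(* For every $n\in\mathbb{N}_0$, every isomorphism class $[\gamma]\in\Gamma^n$ of colored trivalent graphs with $2n$ vertices occurs with non-zero coefficient in the Pfaffian $\mathrm{pf}_n\in\mathbb{A}^n$. Moreover, in the power series completion $\prod_{n\geq0}\mathbb{A}^n$ of the graded algebra $\mathbb{A}^\bullet$ of colored trivalent graphs the total Pfaffian equals the exponential $$\sum_{n\geq0}\mathrm{pf}_n\;=\;\exp\Big(\sum_{[\gamma]\in\Gamma^\bullet_{\mathrm{conn}}}\frac{(-1)^{e(\gamma)}}{6^{n(\gamma)}}\;\frac{2^{g(\gamma)}}{\#\overline{\mathrm{Aut}}\,\gamma}\;[\gamma]\Big),$$ where $n(\gamma):=\frac12\,\#\mathrm{Vert}\,\gamma$ is the degree of $\gamma$, while $e(\gamma)$ and $g(\gamma)$ are the numbers of cycles of the black subgraph $\gamma_{\mathrm{black}}$ of even length and of length greater than $2$ respectively.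
   Context: Graphs. A finite graph $\gamma$ consists of finite sets $\mathrm{Vert}\,\gamma$ of vertices and $\mathrm{Flag}\,\gamma$ of flags (half-edges), a fixed point free involution $\theta$ of $\mathrm{Flag}\,\gamma$ and an attaching map $\mathrm{Flag}\,\gamma\to\mathrm{Vert}\,\gamma$; the edges are the orbits of $\theta$. Loops and multiple edges are allowed. A colored trivalent graph is such a graph in which every vertex has exactly three flags, with a $\theta$-invariant coloring of the flags in red and black such that every vertex is adjacent to exactly one red flag (so red edges join different vertices). The black subgraph $\gamma_{\mathrm{black}}$ is obtained by removing all red edges; it is bivalent and hence a disjoint union of cycles of length $\geq1$ (a loop is a cycle of length $1$, a pair of parallel black edges a cycle of length $2$). Isomorphisms are pairs of bijections of vertices and flags compatible with the involutions, attaching maps and colorings. $\overline{\mathrm{Aut}}\,\gamma$ is the group of permutations of $\mathrm{Vert}\,\gamma$ induced by the automorphisms of the colored graph $\gamma$. $\Gamma^n$ is the set of isomorphism classes of colored trivalent graphs with $2n$ vertices, $\Gamma^\bullet=\bigcup_n\Gamma^n$ is a graded commutative monoid under disjoint union (with the class of the empty graph as unit), and $\Gamma^\bullet_{\mathrm{conn}}\subseteq\Gamma^\bullet$ is the subset of classes of (non-empty) connected graphs. The algebra of colored trivalent graphs is the monoid algebra $\mathbb{A}^\bullet:=\mathbb{R}\,\Gamma^\bullet$, graded by $\mathbb{A}^n:=\mathbb{R}\,\Gamma^n$. Pfaffian. $\mathrm{pf}_0:=1$ and for $n>0$ $$\mathrm{pf}_n:=\frac{1}{12^n\,n!}\sum_{\sigma\in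 S_{2n}}(\mathrm{sgn}\,\sigma)\,[\gamma_\sigma]\in\mathbb{A}^n,$$ where $\gamma_\sigma$ is the colored trivalent graph with vertex set $\{1,\ldots,2n\}$, red edges joining $2r-1$ with $2r$ for $r=1,\ldots,n$, and in which each vertex $i$ has two black flags, a lower one and an upper one, such that for every $i$ a black edge joins the upper flag of $i$ to the lower flag of $\sigma(i)$ (a loop if $\sigma(i)=i$). *)

(* Defs.v *)
From HB Require Import structures.
From mathcomp Require Import all_boot all_order all_fingroup all_algebra.
From mathcomp Require Import generic_quotient finmap.
From mathcomp Require Import mathcomp_extra boolp classical_sets functions.
From mathcomp Require Import cardinality fsbigop reals.
From mathcomp Require Export monalg.

Set Implicit Arguments.
Unset Strict Implicit.
Unset Printing Implicit Defensive.

Import GRing.Theory Num.Theory.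

Local Open Scope quotient_scope.
Local Open Scope ring_scope.

Record graph := Graph {
  vert : finType;
  flag : finType;
  theta : flag -> flag;
  att : flag -> vert;
  thetaK : involutive theta;
  theta_free : forall f, theta f != f
}.

Definition adj (G : graph) : rel (vert G) :=
  fun u v => [exists f : flag G, (att f == u) && (att (theta f) == v)].

Definition components (G : graph) : {set {set vert G}} :=
  equivalence_partition (connect (@adj G)) [set: vert G].

(* In particular the empty graph is not connected. *)
Definition connected (G : graph) : bool := #|components G| == 1%N.

Record is_ctgraph (V F : finType) (th : F -> F) (at_ : F -> V)
    (rd : F -> bool) : Prop := IsCTGraph {
  ct_invol : involutive th;
  ct_free : forall f, th f != f;
  ct_color : forall f, rd (th f) = rd f;
  ct_trivalent : forall v, #|[pred f | at_ f == v]| = 3%N;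
  ct_one_red : forall v, #|[pred f | (at_ f == v) && rd f]| = 1%N
}.

Record ctgraph := CTGraph {
  cvert : finType;
  cflag : finType;
  ctheta : cflag -> cflag;
  catt : cflag -> cvert;
  red : cflag -> bool;
  ctgraphP : is_ctgraph ctheta catt red
}.

Coercion forget_color (g : ctgraph) : graph :=
  Graph (@catt g) (ct_invol (ctgraphP g)) (ct_free (ctgraphP g)).

Section Black.
Variable g : ctgraph.

Definition black_flag := {f : cflag g | ~~ red f}.

Lemma black_theta_subproof (f : black_flag) : ~~ red (ctheta (val f)).
Proof. by rewrite (ct_color (ctgraphP g)) (valP f). Qed.

Definition black_theta (f : black_flag) : black_flag :=
  Sub (ctheta (val f)) (black_theta_subproof f).

Lemma black_thetaK : involutive black_theta.
Proof. by move=> f; apply: val_inj; rewrite /= (ct_invol (ctgraphP g)). Qed.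

Lemma black_theta_free f : black_theta f != f.
Proof. by rewrite -val_eqE /= (ct_free (ctgraphP g)). Qed.

Definition black : graph :=
  @Graph (cvert g) black_flag black_theta (fun f => catt (val f))
    black_thetaK black_theta_free.

End Black.

(* The components of the black subgraph are its cycles, and the length of a *)
(* cycle is its number of vertices.                                         *)
Definition num_even_cycles (g : ctgraph) : nat :=
  #|[set C in components (black g) | ~~ odd #|C|]|.

Definition num_long_cycles (g : ctgraph) : nat :=
  #|[set C in components (black g) | (2 < #|C|)%N]|.

Definition is_iso (g h : ctgraph) (fv : cvert g -> cvert h)
    (ff : cflag g -> cflag h) : Prop :=
  [/\ bijective fv, bijective ff,
      forall f, ff (ctheta f) = ctheta (ff f),
      forall f, fv (catt f) = catt (ff f)
    & forall f, red (ff f) = red f].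

Definition iso (g h : ctgraph) : Prop :=
  exists (fv : cvert g -> cvert h) (ff : cflag g -> cflag h), is_iso fv ff.

Definition autbar (g : ctgraph) : {set {perm cvert g}} :=
  [set p : {perm cvert g} |
    `[< exists ff : cflag g -> cflag g, is_iso p ff >]].

Lemma iso_refl g : iso g g.
Proof. by exists id, id; split=> //; exists id. Qed.

Lemma iso_sym g h : iso g h -> iso h g.
Proof.
move=> [fv [ff [[gv fvK gvK] [gf ffK gfK] ht ha hr]]].
exists gv, gf; split; first by exists fv.
- by exists ff.
- by move=> f; apply: (can_inj ffK); rewrite ht !gfK.
- by move=> f; apply: (can_inj fvK); rewrite gvK ha gfK.
- by move=> f; rewrite -hr gfK.
Qed.

Lemma iso_trans g h k : iso g h -> iso h k -> iso g k.
Proof.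
move=> [fv [ff [bv bf ht ha hr]]] [fv' [ff' [bv' bf' ht' ha' hr']]].
exists (fv' \o fv), (ff' \o ff); split; do ?exact: bij_comp.
- by move=> f /=; rewrite ht ht'.
- by move=> f /=; rewrite ha ha'.
- by move=> f /=; rewrite hr' hr.
Qed.

Lemma iso_card g h : iso g h -> #|cvert g| = #|cvert h|.
Proof. by move=> [fv [ff [bv _ _ _ _]]]; exact: bij_eq_card bv. Qed.

(* Isomorphism classes. All colored trivalent graphs together live in too   *)
(* large a universe to be an [eqType]; every one of them is isomorphic to   *)
(* one whose vertices and flags form initial segments of nat, so that the   *)
(* quotient is taken on those. Lemmas [ctclassP] and [repK] below state     *)
(* that [ctclass] is the set of isomorphism classes of all [ctgraph]s.      *)

Record skeleton := Skeleton {
  nvert : nat;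
  nflag : nat;
  stheta : {ffun 'I_nflag -> 'I_nflag};
  satt : {ffun 'I_nflag -> 'I_nvert};
  sred : {ffun 'I_nflag -> bool};
  skeletonP : is_ctgraph stheta satt sred
}.

HB.instance Definition _ := gen_eqMixin skeleton.
HB.instance Definition _ := gen_choiceMixin skeleton.

Definition of_skeleton (s : skeleton) : ctgraph := CTGraph (skeletonP s).

Definition skeleton_iso : rel skeleton :=
  fun s t => `[< iso (of_skeleton s) (of_skeleton t) >].

Lemma skeleton_iso_refl : reflexive skeleton_iso.
Proof. by move=> s; apply/asboolP; exact: iso_refl. Qed.

Lemma skeleton_iso_sym : symmetric skeleton_iso.
Proof. by move=> s t; apply/asboolP/asboolP => /iso_sym. Qed.

Lemma skeleton_iso_trans : transitive skeleton_iso.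
Proof.
move=> t s u /asboolP st /asboolP tu; apply/asboolP; exact: iso_trans st tu.
Qed.

Canonical skeleton_iso_equiv :=
  EquivRel skeleton_iso skeleton_iso_refl skeleton_iso_sym skeleton_iso_trans.

Definition ctclass : Type := {eq_quot skeleton_iso}.

HB.instance Definition _ := Choice.copy ctclass {eq_quot skeleton_iso}.

Lemma reindex_card (A B : finType) (f : A -> B) (P : pred B) :
  bijective f -> #|[pred a | P (f a)]| = #|P|.
Proof.
move=> bf; rewrite -!sum1_card (reindex f) //=.
by apply: onW_bij.
Qed.

Section Skeletonize.
Variable g : ctgraph.

Let fth := [ffun i : 'I_#|cflag g| => enum_rank (ctheta (enum_val i))].
Let fat := [ffun i : 'I_#|cflag g| => enum_rank (catt (enum_val i))].
Let frd := [ffun i : 'I_#|cflag g| => red (enum_val i)].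

Lemma skeletonize_subproof : is_ctgraph fth fat frd.
Proof.
case: (ctgraphP g) => c1 c2 c3 c4 c5.
split.
- by move=> i; rewrite !ffunE enum_rankK c1 enum_valK.
- by move=> i; rewrite ffunE -(inj_eq enum_val_inj) enum_rankK c2.
- by move=> i; rewrite !ffunE enum_rankK c3.
- move=> v; apply: etrans (c4 (enum_val v)).
  apply: etrans (reindex_card _ (@enum_val_bij (cflag g))).
  by apply: eq_card => i; rewrite !inE ffunE -(inj_eq enum_val_inj) enum_rankK.
- move=> v; apply: etrans (c5 (enum_val v)).
  apply: etrans (reindex_card _ (@enum_val_bij (cflag g))).
  by apply: eq_card => i; rewrite !inE !ffunE -(inj_eq enum_val_inj) enum_rankK.
Qed.

Definition skeletonize : skeleton := Skeleton skeletonize_subproof.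

Lemma skeletonize_iso : iso g (of_skeleton skeletonize).
Proof.
exists enum_rank, enum_rank; split; do ?exact: enum_rank_bij.
- by move=> f; rewrite /= ffunE enum_rankK.
- by move=> f; rewrite /= ffunE enum_rankK.
- by move=> f; rewrite /= ffunE enum_rankK.
Qed.

End Skeletonize.

Definition class_of (g : ctgraph) : ctclass :=
  \pi_({eq_quot skeleton_iso}) (skeletonize g).

Definition rep (x : ctclass) : ctgraph :=
  of_skeleton (repr (x : {eq_quot skeleton_iso})).

Lemma ctclassP g h : class_of g = class_of h <-> iso g h.
Proof.
split.
  move/eqP; rewrite /class_of piE => /asboolP gh.
  exact: iso_trans (skeletonize_iso g) (iso_trans gh (iso_sym (skeletonize_iso h))).
move=> gh; apply/eqP; rewrite /class_of piE; apply/asboolP.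
exact: iso_trans (iso_sym (skeletonize_iso g)) (iso_trans gh (skeletonize_iso h)).
Qed.

Lemma repK x : class_of (rep x) = x.
Proof.
rewrite -[RHS]reprK; apply/eqP; rewrite /class_of piE; apply/asboolP.
exact: iso_sym (skeletonize_iso _).
Qed.

Lemma rep_class_of g : iso (rep (class_of g)) g.
Proof. by apply/ctclassP; rewrite repK. Qed.

Lemma empty_subproof :
  is_ctgraph (id : void -> void) (id : void -> void) (fun=> true).
Proof. by split; case. Qed.

Definition empty_ctgraph : ctgraph := CTGraph empty_subproof.

Section DisjointUnion.
Variables g h : ctgraph.

Definition union_theta (f : cflag g + cflag h) : cflag g + cflag h :=
  match f with inl f => inl (ctheta f) | inr f => inr (ctheta f) end.

Definition union_att (f : cflag g + cflag h) : cvert g + cvert h :=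
  match f with inl f => inl (catt f) | inr f => inr (catt f) end.

Definition union_red (f : cflag g + cflag h) : bool :=
  match f with inl f => red f | inr f => red f end.

Lemma union_subproof : is_ctgraph union_theta union_att union_red.
Proof.
case: (ctgraphP g) => a1 a2 a3 a4 a5; case: (ctgraphP h) => b1 b2 b3 b4 b5.
have cardS (A B : finType) (P : pred (A + B)) :
    #|P| = (#|[pred a | P (inl a)]| + #|[pred b | P (inr b)]|)%N.
  by rewrite -!sum1_card big_sumType.
split.
- by case=> f /=; rewrite ?a1 ?b1.
- case=> f /=.
    by apply/eqP => -[/eqP]; apply/negP; exact: a2.
  by apply/eqP => -[/eqP]; apply/negP; exact: b2.
- by case=> f /=; rewrite ?a3 ?b3.
- case=> v; rewrite cardS.
    rewrite -[RHS](a4 v) [X in (_ + X)%N](_ : _ = 0%N) ?addn0 //.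
    exact: eq_card0.
  rewrite -[RHS](b4 v) [X in (X + _)%N](_ : _ = 0%N) ?add0n //.
  exact: eq_card0.
- case=> v; rewrite cardS.
    rewrite -[RHS](a5 v) [X in (_ + X)%N](_ : _ = 0%N) ?addn0 //.
    exact: eq_card0.
  rewrite -[RHS](b5 v) [X in (X + _)%N](_ : _ = 0%N) ?add0n //.
  exact: eq_card0.
Qed.

Definition disjoint_union : ctgraph := CTGraph union_subproof.

End DisjointUnion.

Lemma union_iso g g' h h' : iso g g' -> iso h h' ->
  iso (disjoint_union g h) (disjoint_union g' h').
Proof.
move=> [fv [ff [[gv fvK gvK] [gf ffK gfK] ht ha hr]]].
move=> [fv' [ff' [[gv' fvK' gvK'] [gf' ffK' gfK'] ht' ha' hr']]].
pose mp A B C D (u : A -> B) (v : C -> D) (x : A + C) : B + D :=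
  match x with inl a => inl (u a) | inr c => inr (v c) end.
exists (mp _ _ _ _ fv fv'), (mp _ _ _ _ ff ff'); split.
- by exists (mp _ _ _ _ gv gv'); case=> x /=; rewrite ?fvK ?fvK' ?gvK ?gvK'.
- by exists (mp _ _ _ _ gf gf'); case=> x /=; rewrite ?ffK ?ffK' ?gfK ?gfK'.
- by case=> x /=; rewrite ?ht ?ht'.
- by case=> x /=; rewrite ?ha ?ha'.
- by case=> x /=; rewrite ?hr ?hr'.
Qed.

Lemma union_isoC g h : iso (disjoint_union g h) (disjoint_union h g).
Proof.
pose sw A B (x : A + B) : B + A :=
  match x with inl a => inr a | inr b => inl b end.
exists (sw _ _), (sw _ _); split; do ?by case.
- by exists (sw _ _); case.
- by exists (sw _ _); case.
Qed.

Lemma union_isoA g h k : iso (disjoint_union g (disjoint_union h k))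
  (disjoint_union (disjoint_union g h) k).
Proof.
pose l A B C (x : A + (B + C)) : (A + B) + C := match x with
  | inl a => inl (inl a) | inr (inl b) => inl (inr b) | inr (inr c) => inr c end.
pose r A B C (x : (A + B) + C) : A + (B + C) := match x with
  | inl (inl a) => inl a | inl (inr b) => inr (inl b) | inr c => inr (inr c) end.
exists (l _ _ _), (l _ _ _); split; do ?by case=> [|[]].
- by exists (r _ _ _); [case=> [|[]] | case=> [[]|]].
- by exists (r _ _ _); [case=> [|[]] | case=> [[]|]].
Qed.

Lemma union_iso0 g : iso (disjoint_union empty_ctgraph g) g.
Proof.
pose d A (x : void + A) : A := match x with inl v => of_void _ v | inr a => a end.
exists (d _), (d _); split; do ?by case=> [[]|].
- by exists inr; [case=> [[]|] | ].
- by exists inr; [case=> [[]|] | ].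
Qed.

Lemma union_eq0 g h : iso (disjoint_union g h) empty_ctgraph ->
  iso g empty_ctgraph.
Proof.
move=> [fv [ff [bv bf _ _ _]]].
have nv (v : cvert g) : False by case: (fv (inl v)).
have nf (f : cflag g) : False by case: (ff (inl f)).
exists (fun v => fv (inl v)), (fun f => ff (inl f)); split=> //.
- by exists (of_void _); [move=> v; case: (nv v) | case].
- by exists (of_void _); [move=> f; case: (nf f) | case].
all: by move=> f; case: (nf f).
Qed.

Definition ctclass1 : ctclass := class_of empty_ctgraph.

Definition ctclassM (x y : ctclass) : ctclass :=
  class_of (disjoint_union (rep x) (rep y)).

Lemma ctclassME g h :
  ctclassM (class_of g) (class_of h) = class_of (disjoint_union g h).
Proof. by apply/ctclassP; apply: union_iso; exact: rep_class_of. Qed.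

Lemma ctclassMA : associative ctclassM.
Proof.
move=> x y z; rewrite -(repK x) -(repK y) -(repK z) !ctclassME.
by apply/ctclassP; exact: union_isoA.
Qed.

Lemma ctclassMC : commutative ctclassM.
Proof. by move=> x y; apply/ctclassP; exact: union_isoC. Qed.

Lemma ctclass1M : left_id ctclass1 ctclassM.
Proof.
move=> x; rewrite -(repK x) /ctclass1 ctclassME.
by apply/ctclassP; exact: union_iso0.
Qed.

Lemma ctclassM1 : right_id ctclass1 ctclassM.
Proof. by move=> x; rewrite ctclassMC ctclass1M. Qed.

Lemma ctclassM_eq1 x y : ctclassM x y = ctclass1 -> x = ctclass1 /\ y = ctclass1.
Proof.
have H a b : ctclassM a b = ctclass1 -> a = ctclass1.
  rewrite -[in X in _ -> X](repK a) => /ctclassP ab; apply/ctclassP.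
  exact: union_eq0 ab.
by move=> xy; split; apply: H; [exact: xy | rewrite ctclassMC; exact: xy].
Qed.

HB.instance Definition _ := Choice_isMonomialDef.Build ctclass
  ctclassMA ctclass1M ctclassM1 ctclassM_eq1.
HB.instance Definition _ := MonomialDef_isConomialDef.Build ctclass ctclassMC.

(* The value of an isomorphism invariant [phi] on an isomorphism class [x]  *)
(* is [phi (rep x)].                                                        *)
Definition ctclasses (n : nat) : set ctclass :=
  [set x | #|cvert (rep x)| = n.*2].

Definition ctclasses_conn : set ctclass := [set x | connected (rep x)].

Definition degree (x : ctclass) : nat := #|cvert (rep x)|./2.

Lemma card_vert_class_of g : #|cvert (rep (class_of g))| = #|cvert g|.
Proof. exact: iso_card (rep_class_of g). Qed.

Lemma card_flag (g : ctgraph) : #|cflag g| = (#|cvert g| * 3)%N.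
Proof.
rewrite -sum1_card (partition_big (@catt g) xpredT) //=.
under eq_bigr do rewrite sum1_card (ct_trivalent (ctgraphP g)).
by rewrite sum_nat_const.
Qed.

Lemma finite_ctclasses n : finite_set (ctclasses n).
Proof.
pose T := ({ffun 'I_(n.*2 * 3) -> 'I_(n.*2 * 3)} *
  {ffun 'I_(n.*2 * 3) -> 'I_(n.*2)} * {ffun 'I_(n.*2 * 3) -> bool})%type.
pose F (c : T) : ctclass := if pselect (is_ctgraph c.1.1 c.1.2 c.2) is left p
  then class_of (of_skeleton (Skeleton p)) else ctclass1.
apply: (@sub_finite_set _ _ (F @` [set: T])); last first.
  exact/finite_image/finite_finset.
move=> x xn /=; rewrite -(repK x); move: xn (card_flag (rep x)).
rewrite /ctclasses /= /rep; case: (repr _) => v f th a r p /=.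
rewrite !card_ord => ev ef; subst v; subst f; exists (th, a, r) => //=.
by rewrite /F /=; case: pselect => //= q; rewrite (Prop_irrelevance q p).
Qed.

(* The algebra of colored trivalent graphs is the monoid algebra            *)
(* [{malg R[ctclass]}]; a _homogeneous_ element of degree n is one that is  *)
(* supported in [ctclasses n].                                              *)
Section Completion.
Variable R : realType.
Local Notation A := {malg R[ctclass]}.

Definition homog (n : nat) (a : A) : Prop :=
  forall x : ctclass, a@_x != 0 -> ctclasses n x.

Lemma homog0 n : homog n 0.
Proof. by move=> x; rewrite mcoeff0 eqxx. Qed.

Lemma homogD n a b : homog n a -> homog n b -> homog n (a + b).
Proof.
move=> ha hb x; rewrite mcoeffD; case: (eqVneq a@_x 0) => [->|/ha //].
by rewrite add0r => /hb.
Qed.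

Lemma homogZ n c a : homog n a -> homog n (c *: a).
Proof.
by move=> ha x; rewrite mcoeffZ mulf_eq0 negb_or => /andP[_ /ha].
Qed.

Lemma homog_sum n (I : Type) (r : seq I) (P : pred I) (F : I -> A) :
  (forall i, P i -> homog n (F i)) -> homog n (\sum_(i <- r | P i) F i).
Proof.
by move=> hF; apply: big_ind => //; [exact: homog0 | exact: homogD].
Qed.

Lemma homogU n x : ctclasses n x -> homog n << x >>.
Proof.
by move=> nx y; rewrite mcoeffU1; case: (eqVneq x y) => [<-|_]; rewrite ?eqxx.
Qed.

Lemma homogM m n a b : homog m a -> homog n b -> homog (m + n) (a * b).
Proof.
move=> ha hb x; rewrite mcoeff_neq0 => /msuppM_le [y [z []]].
rewrite -!mcoeff_neq0 => /ha hy /hb hz ->.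
rewrite /ctclasses /= card_vert_class_of /= card_sum doubleD.
by rewrite [X in (X + _)%N]hy [X in (_ + X)%N]hz.
Qed.

Lemma homog1 : homog 0 1.
Proof.
apply: homogU; rewrite /ctclasses /= card_vert_class_of /=.
exact: card_void.
Qed.

Record completion := Completion {
  comp :> nat -> A;
  compP : forall n, homog n (comp n)
}.

Lemma completionP (a b : completion) : (forall n, a n = b n) <-> a = b.
Proof.
split=> [ab|->//]; case: a b ab => a ha [b hb] /= /funext ab.
by subst b; rewrite (Prop_irrelevance ha hb).
Qed.

Lemma completion1_subproof n : homog n (if n == 0%N then 1 else 0 : A).
Proof. by case: n => [|n] /=; [exact: homog1 | exact: homog0]. Qed.

Definition completion1 : completion := Completion completion1_subproof.

Lemma completionM_subproof (a b : completion) n :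
  homog n (\sum_(i < n.+1) a i * b (n - i)%N).
Proof.
apply: homog_sum => i _; move: (homogM (@compP a i) (@compP b (n - i)%N)).
by rewrite subnKC // -ltnS.
Qed.

Definition completionM (a b : completion) : completion :=
  Completion (@completionM_subproof a b).

Definition completionX (a : completion) (k : nat) : completion :=
  iter k (completionM a) completion1.

(* For [a 0 = 0], the case in which the exponential series converges in     *)
(* every degree, [a ^ k] has no component of degree [n < k], hence the      *)
(* series may be cut off at [k = n]; see [completion_expE].                 *)
Lemma completion_exp_subproof (a : completion) n :
  homog n (\sum_(k < n.+1) (k`!%:R)^-1 *: completionX a k n).
Proof. by apply: homog_sum => k _; apply: homogZ; exact: compP. Qed.

Definition completion_exp (a : completion) : completion :=
  Completion (@completion_exp_subproof a).

Lemma completionX_lt (a : completion) (k n : nat) :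
  a 0%N = 0 -> (n < k)%N -> completionX a k n = 0.
Proof.
move=> a0; elim: k n => // k IHk n; rewrite ltnS => nk /=.
apply: big1 => -[[|i] /= lin] _; first by rewrite a0 mul0r.
rewrite -/(completionX a k) IHk ?mulr0 //; apply: leq_trans nk.
by rewrite ltn_subrL (leq_ltn_trans (leq0n i) lin).
Qed.

Lemma completion_expE (a : completion) (n N : nat) : a 0%N = 0 -> (n < N)%N ->
  completion_exp a n = \sum_(k < N) (k`!%:R)^-1 *: completionX a k n.
Proof.
move=> a0 nN; rewrite /= (big_ord_widen N (fun k => (k`!%:R)^-1 *: completionX a k n)) //.
rewrite big_mkcond; apply: eq_bigr => k _; case: ltnP => // kn.
by rewrite completionX_lt ?scaler0.
Qed.

(* The component of degree n is a finite sum by [finite_ctclasses]          *)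
Lemma formal_sum_subproof (P : set ctclass) (c : ctclass -> R) n :
  homog n (\sum_(x \in ctclasses n `&` P) c x *: << x >>).
Proof.
rewrite fsbig_finite /=; last exact/finite_setIl/finite_ctclasses.
rewrite big_seq; apply: homog_sum => x.
rewrite in_fset_set; last exact/finite_setIl/finite_ctclasses.
by rewrite inE => -[nx _]; apply: homogZ; exact: homogU.
Qed.

Definition formal_sum (P : set ctclass) (c : ctclass -> R) : completion :=
  Completion (@formal_sum_subproof P c).

End Completion.

(* Vertices are numbered from 0, so that the red edges join                 *)
(* 2r with 2r+1. The flags of the vertex i are the red one (i, None), the   *)
(* lower black one (i, Some false) and the upper black one (i, Some true).  *)

Section GammaSigma.
Variables (n : nat) (s : 'S_(n.*2)).

Definition mate (i : nat) : nat := if odd i then i.-1 else i.+1.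

Lemma mate_subproof (i : 'I_(n.*2)) : (mate i < n.*2)%N.
Proof.
rewrite /mate; case: ifPn => oi; first exact: leq_ltn_trans (leq_pred i) _.
rewrite ltn_neqAle ltn_ord andbT; apply: contra oi => /eqP e.
by rewrite -[odd i]negbK -oddS e odd_double.
Qed.

Definition gamma_theta (f : 'I_(n.*2) * option bool) : 'I_(n.*2) * option bool :=
  match f with
  | (i, None) => (Ordinal (mate_subproof i), None)
  | (i, Some true) => (s i, Some false)
  | (i, Some false) => ((s^-1)%g i, Some true)
  end.

Definition gamma_red (f : 'I_(n.*2) * option bool) : bool := f.2 == None.

Lemma mateK : involutive mate.
Proof.
move=> i; rewrite /mate; case: (boolP (odd i)) => oi.
  by case: i oi => //= i /negbTE ->.
by rewrite /= oi.
Qed.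

Lemma gamma_subproof : is_ctgraph gamma_theta (fun f => f.1) gamma_red.
Proof.
split.
- case=> i [[]|] /=; rewrite ?permK ?permKV //; congr (_, _).
  by apply: val_inj; rewrite /= mateK.
- case=> i [[]|] /=; rewrite xpair_eqE ?andbF // andbT -val_eqE /= /mate.
  case: ifP => oi; last by rewrite neq_ltn ltnSn orbT.
  by case: (i : nat) oi => // k _ /=; rewrite neq_ltn ltnSn.
- by case=> i [[]|].
- move=> v; rewrite (@eq_card _ _ [predX pred1 v & predT]).
    by rewrite cardX card1 card_option card_bool.
  by case=> i o; rewrite !inE andbT.
- move=> v; rewrite (@eq_card _ _ (pred1 (v, None))) ?card1 //.
Qed.

Definition gamma_ : ctgraph := CTGraph gamma_subproof.

End GammaSigma.

Section Pfaffian.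
Variable R : realType.

Definition pf (n : nat) : {malg R[ctclass]} :=
  if n == 0%N then 1 else
  ((12 ^ n * n`!)%N%:R)^-1 *: \sum_(s : 'S_(n.*2)) (-1) ^+ s *: << class_of (gamma_ s) >>.

Lemma pf_homog n : homog n (pf n).
Proof.
rewrite /pf; case: eqP => [->|_]; first exact: homog1.
apply/homogZ/homog_sum => s _; apply/homogZ/homogU.
by rewrite /ctclasses /= card_vert_class_of card_ord.
Qed.

Definition total_pf : completion R := Completion pf_homog.

End Pfaffian.

(* Main.v *)
Require Import Defs.
From mathcomp Require Import all_boot all_order all_fingroup all_algebra.
From mathcomp Require Import boolp reals ring.

Set Implicit Arguments.
Unset Strict Implicit.
Unset Printing Implicit Defensive.

Import GRing.Theory Num.Theory.

Local Open Scope ring_scope.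

(** Orient every cycle of the black subgraph of a colored trivalent graph: the
graph then becomes a permutation s of its vertices, together with the
fixed-point free involution given by the red edges ([ctgraph_std]).  The
Pfaffian is therefore, up to the factor 1 / (12^n n!), the sum of
sgn(s) [graph of s] over all permutations s of one fixed set of n red pairs
([pf_signed_sum]).

The coefficient of a class x.  The black cycles of the graph of s are the cycles
of s, so sgn(s) = (-1)^e, where e counts the even ones: all terms that
contribute to x have the same sign, and nothing cancels.  Their number comes
from counting pairs (s, p), where p is a relabelling of the vertices carrying
the graph of s to that of a fixed representative s0 ([count_mgraph_iso]).  For
each s in the class of x, the relabellings p form a coset of Autbar(x).  For each
of the 2^n n! relabellings p that respect the red pairs, the suitable s are the
permutations conjugate by p to some t with the same unoriented edges as s0, and
such a t reverses an arbitrary set of cycles of s0; a reversal is visible exactly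
on the g cycles of length greater than 2 ([card_same_edges]).  Hence x has
2^n n! 2^g / #Autbar(x) permutations, and its coefficient is
(-1)^e 6^-n 2^g / #Autbar(x), which is not zero ([pf_coefficientE]).

The exponential formula.  Multiply each term of the signed sum P_n by the number
n of red pairs, and distribute this weight over the components.  A component is a
union of k red pairs, and s splits into a permutation of them with connected
graph and an arbitrary permutation of the other pairs; signs and classes multiply
([sum_component]).  With P^c for the sum over connected graphs this gives
[[
  n P_n = sum_k k binomial(n, k) P^c_k P_(n-k),
]]
which, after normalization, says that the Euler derivation D (multiplication by
n in degree n) satisfies D F = (D L) F for the total Pfaffian F and its connected
part L ([pf_recursion]).  As L_0 = 0 and F_0 = 1, this equation has exp L as its
only solution ([completion_exp_unique]).  By the first part, applied to connected
classes, the coefficients of L are those of the theorem. *)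

(** * Extending permutations along injections *)

Section PermExtension.
Variables (T T' : finType) (f : T -> T').
Hypothesis f_inj : injective f.

Definition perm_ext_fun (s : {perm T}) (y : T') : T' :=
  if [pick x | f x == y] is Some x then f (s x) else y.

Lemma perm_ext_funE s x : perm_ext_fun s (f x) = f (s x).
Proof.
rewrite /perm_ext_fun; case: pickP => [z /eqP/f_inj->//|/(_ x)].
by rewrite eqxx.
Qed.

Lemma perm_ext_fun_inj s : injective (perm_ext_fun s).
Proof.
apply: (can_inj (g := perm_ext_fun s^-1%g)) => y.
rewrite {2}/perm_ext_fun; case: pickP => [x /eqP <-|ny].
  by rewrite perm_ext_funE permK.
by rewrite /perm_ext_fun; case: pickP => // x; rewrite ny.
Qed.

Definition perm_ext s : {perm T'} := perm (@perm_ext_fun_inj s).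

Lemma perm_extE (s : {perm T}) x : perm_ext s (f x) = f (s x).
Proof. by rewrite permE perm_ext_funE. Qed.

Lemma perm_ext_out (s : {perm T}) y : (forall x, f x != y) -> perm_ext s y = y.
Proof.
move=> ny; rewrite permE /perm_ext_fun; case: pickP => // x.
by rewrite (negbTE (ny x)).
Qed.

Lemma perm_ext_uniq (s : {perm T}) (t : {perm T'}) :
  (forall x, t (f x) = f (s x)) ->
  (forall y, (forall x, f x != y) -> t y = y) -> t = perm_ext s.
Proof.
move=> tf tout; apply/permP => y.
case: (pickP (fun x => f x == y)) => [x /eqP <-|ny]; first by rewrite perm_extE.
by rewrite tout ?perm_ext_out // => x; rewrite ny.
Qed.

Lemma perm_extM (s t : {perm T}) : perm_ext (s * t)%g = (perm_ext s * perm_ext t)%g.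
Proof.
apply/esym/perm_ext_uniq => [x|y ny]; first by rewrite !permM !perm_extE.
by rewrite permM !perm_ext_out.
Qed.

(** Extension is multiplicative and sends transpositions to transpositions. *)
Lemma odd_perm_ext (s : {perm T}) : perm_ext s = s :> bool.
Proof.
case: (prod_tpermP s) => ts -> _; elim: ts => [|[x y] ts IH].
  rewrite !big_nil -(@perm_ext_uniq 1%g 1%g) ?odd_perm1 // => *; by rewrite !perm1.
rewrite !big_cons perm_extM !odd_permM IH; congr (_ (+) _).
rewrite -(@perm_ext_uniq (tperm x y) (tperm (f x) (f y))).
- by rewrite !odd_tperm (inj_eq f_inj).
- by move=> z; apply/esym/inj_tperm.
- by move=> z nz; rewrite tpermD.
Qed.

End PermExtension.

(** * Components and isomorphism invariance *)

Definition component_of (G : graph) (x : vert G) : {set vert G} :=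
  [set y | connect (@adj G) x y].

Lemma adj_sym (G : graph) : symmetric (@adj G).
Proof.
suff H (u v : vert G) : adj u v -> adj v u by move=> u v; apply/idP/idP; exact: H.
case/existsP => f /andP[fu fv]; apply/existsP; exists (theta f).
by rewrite fv thetaK.
Qed.

Lemma connect_adj_sym (G : graph) : connect_sym (@adj G).
Proof. exact/sym_connect_sym/adj_sym. Qed.

Lemma componentsE (G : graph) :
  components G = [set component_of x | x in [set: vert G]].
Proof.
by apply: eq_imset => x; apply/setP => y; rewrite !inE.
Qed.

Lemma component_of_in (G : graph) (x : vert G) : component_of x \in components G.
Proof. by rewrite componentsE imset_f ?inE. Qed.

Lemma component_of_eq (G : graph) (x : vert G) (C : {set vert G}) :
  C \in components G -> x \in C -> C = component_of x.
Proof.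
rewrite componentsE => /imsetP[z _ ->]; rewrite inE => zx.
by apply/setP => t; rewrite !inE (same_connect (@connect_adj_sym G) zx).
Qed.

Lemma components_partition (G : graph) : partition (components G) [set: vert G].
Proof.
apply: equivalence_partitionP => x y z _ _ _; split; first exact: connect0.
by move/(same_connect (@connect_adj_sym G)).
Qed.

Lemma connectedE (G : graph) : connected G = ([set: vert G] \in components G).
Proof.
rewrite /connected; apply/idP/idP => [/cards1P[C eC]|TC].
  suff -> : [set: vert G] = C by rewrite eC set11.
  apply/setP => y; rewrite inE; apply/esym.
  have /set1P <- : component_of y \in [set C] by rewrite -eC component_of_in.
  by rewrite inE connect0.
apply/cards1P; exists [set: vert G]; apply/setP => C; rewrite inE.
apply/idP/eqP => [CG|->//].
move: (CG); rewrite componentsE => /imsetP[x _ eC].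
by rewrite eC (@component_of_eq _ x [set: vert G]).
Qed.

(** The second clause makes the image a union of components.  The notion covers
both isomorphisms and the inclusion of one part of a disjoint union. *)
Definition open_embedding (G H : graph) (f : vert G -> vert H) : Prop :=
  [/\ injective f, forall x y, adj (f x) (f y) = adj x y
    & forall x z, adj (f x) z -> exists y, z = f y].

Lemma component_of_embedding (G H : graph) (f : vert G -> vert H) (x : vert G) :
  open_embedding f -> component_of (f x) = f @: component_of x.
Proof.
move=> [f_inj fadj fopen]; apply/setP => z; rewrite inE; apply/idP/imsetP.
  case/connectP => p; elim: p x => [|z1 p IH] x /=.
    by move=> _ ->; exists x; rewrite ?inE.
  case/andP => xz1; have [y1 ez1] := fopen _ _ xz1; subst z1.
  move=> py1 /(IH _ py1)[y]; rewrite inE => y1y ->; exists y => //.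
  by rewrite inE (connect_trans _ y1y) // connect1 // -fadj.
case=> y; rewrite inE => /connectP[p + -> ->]; elim: p x => //= y1 p IH x.
case/andP => xy1 /IH; apply: connect_trans; by rewrite connect1 // fadj.
Qed.

(** Together with the next two lemmas, this gives the isomorphism invariance of
connectedness and of the numbers of black cycles of prescribed length. *)
Lemma components_iso (G H : graph) (f : vert G -> vert H) :
  open_embedding f -> bijective f ->
  components H = [set f @: (C : {set vert G}) | C in components G].
Proof.
move=> femb [g fK gK]; apply/setP => C; apply/idP/imsetP.
  rewrite componentsE => /imsetP[y _ ->]; exists (component_of (g y)).
    exact: component_of_in.
  by rewrite -component_of_embedding // gK.
case=> D; rewrite componentsE => /imsetP[x _ ->] ->.
by rewrite -component_of_embedding ?component_of_in.
Qed.

Lemma card_components_iso (G H : graph) (f : vert G -> vert H) (P : pred nat) :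
  open_embedding f -> bijective f ->
  #|[set C in components H | P #|C|]| = #|[set C in components G | P #|C|]|.
Proof.
move=> femb fbij; have f_inj := bij_inj fbij.
rewrite -(card_imset (mem [set C in components G | P #|C|]) (imset_inj f_inj)).
apply: eq_card => D; rewrite inE (components_iso femb fbij).
apply/andP/imsetP => [[/imsetP[C CG ->]]|[C]].
  by rewrite card_imset // => PC; exists C; rewrite ?inE ?CG.
rewrite inE => /andP[CG PC] ->; rewrite card_imset //; split=> //.
exact: imset_f.
Qed.

Lemma connected_iso_graph (G H : graph) (f : vert G -> vert H) :
  open_embedding f -> bijective f -> connected H = connected G.
Proof.
move=> femb fbij; rewrite /connected (components_iso femb fbij).
by rewrite card_imset //; apply: imset_inj; apply: bij_inj.
Qed.

Section IsoInvariants.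
Variables (g h : ctgraph) (fv : cvert g -> cvert h) (ff : cflag g -> cflag h).
Hypothesis fiso : is_iso fv ff.

Lemma iso_adj (u v : cvert g) : @adj h (fv u) (fv v) = @adj g u v.
Proof.
case: fiso => /bij_inj fvi [gf ffK gfK] ht ha hr.
apply/existsP/existsP => -[f /= /andP[/eqP fu /eqP fv']].
  by exists (gf f); rewrite -!(inj_eq fvi) !ha ht gfK fu fv' !eqxx.
by exists (ff f); rewrite -ht -!ha fu fv' !eqxx.
Qed.

Lemma iso_open_embedding : @open_embedding g h fv.
Proof.
case: (fiso) => fvb _ _ _ _; split; [exact: bij_inj|exact: iso_adj|].
by move=> x z _; case: fvb => gv _ gvK; exists (gv z).
Qed.

Lemma iso_black_open_embedding : @open_embedding (black g) (black h) fv.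
Proof.
case: fiso => fvb [gf ffK gfK] ht ha hr; have fvi := bij_inj fvb.
have hb f : ~~ red (gf f) = ~~ red f by rewrite -hr gfK.
split=> //; last by move=> x z _; case: fvb => gv _ gvK; exists (gv z).
move=> u v; apply/existsP/existsP => -[[f fb] /= /andP[/eqP fu /eqP fv']].
  have fb' : ~~ red (gf f) by rewrite hb.
  exists (Sub (gf f) fb').
  by rewrite /= -!(inj_eq fvi) !ha ht gfK fu fv' !eqxx.
have fb' : ~~ red (ff f) by rewrite hr.
by exists (Sub (ff f) fb'); rewrite /= -ht -!ha fu fv' !eqxx.
Qed.

End IsoInvariants.

Lemma iso_connected (g h : ctgraph) : iso g h -> connected g = connected h.
Proof.
move=> [fv [ff fiso]]; apply/esym/connected_iso_graph.
  exact: iso_open_embedding fiso.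
by case: fiso.
Qed.

Lemma iso_num_even_cycles (g h : ctgraph) :
  iso g h -> num_even_cycles g = num_even_cycles h.
Proof.
move=> [fv [ff fiso]]; apply: esym.
apply: (@card_components_iso (black g) (black h) fv (fun k => ~~ odd k)).
  exact: iso_black_open_embedding fiso.
by case: fiso.
Qed.

Lemma iso_num_long_cycles (g h : ctgraph) :
  iso g h -> num_long_cycles g = num_long_cycles h.
Proof.
move=> [fv [ff fiso]]; apply: esym.
apply: (@card_components_iso (black g) (black h) fv (fun k => 2 < k)%N).
  exact: iso_black_open_embedding fiso.
by case: fiso.
Qed.

Lemma is_iso_inv (g h : ctgraph) fv ff fv' ff' :
  @is_iso g h fv ff -> cancel fv fv' -> cancel ff ff' -> @is_iso h g fv' ff'.
Proof.
move=> [bv bf ht ha hr] fvK ffK.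
have fvK' : cancel fv' fv by apply/(bij_can_sym bv).
have ffK' : cancel ff' ff by apply/(bij_can_sym bf).
have bfi := bij_inj bf; have bvi := bij_inj bv.
split; [by exists fv|by exists ff|..] => f.
- by apply: bfi; rewrite ht !ffK'.
- by apply: bvi; rewrite ha ffK' fvK'.
- by rewrite -hr ffK'.
Qed.

Lemma is_iso_comp (g h k : ctgraph) fv ff fv' ff' :
  @is_iso g h fv ff -> @is_iso h k fv' ff' -> is_iso (fv' \o fv) (ff' \o ff).
Proof.
move=> [bv bf ht ha hr] [bv' bf' ht' ha' hr']; split; do ?exact: bij_comp.
- by move=> f /=; rewrite ht ht'.
- by move=> f /=; rewrite ha ha'.
- by move=> f /=; rewrite hr' hr.
Qed.

(** Conjugation by the vertex part of an isomorphism. *)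
Lemma leq_autbar (g h : ctgraph) : iso g h -> (#|autbar g| <= #|autbar h|)%N.
Proof.
move=> [fv [ff fiso]]; have [[gv fvK gvK] [gf ffK gfK] _ _ _] := fiso.
have inj (p : {perm cvert g}) : injective (fv \o p \o gv).
  by move=> x y /= /(can_inj fvK)/perm_inj/(can_inj gvK).
rewrite -(card_imset _ (f := fun p => perm (inj p))); last first.
  move=> p q /permP e; apply/permP => x.
  by move: (e (fv x)); rewrite !permE /= !fvK => /(can_inj fvK).
apply/subset_leq_card/subsetP => _ /imsetP[p + ->]; rewrite !inE.
move=> /asboolP[fp pP]; apply/asboolP; exists (ff \o fp \o gf).
rewrite (_ : fun_of_perm _ = fv \o p \o gv); last by apply/funext => x; rewrite permE.
apply: is_iso_comp (is_iso_comp pP fiso).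
exact: is_iso_inv fiso fvK ffK.
Qed.

Lemma iso_autbar (g h : ctgraph) : iso g h -> #|autbar g| = #|autbar h|.
Proof. by move=> gh; apply/eqP; rewrite eqn_leq !leq_autbar //; exact: iso_sym. Qed.

(** * Graphs of permutations of a matched set *)

(** The set of vertices together with the perfect matching by the red edges. *)
Record matching := Matching {
  point :> finType;
  partner : point -> point;
  partnerK : involutive partner;
  partner_free : forall x, partner x != x
}.

Section MatchedGraph.
Variables (M : matching) (s : {perm M}).

(** The flags at x are, as in [gamma_theta], the red one (x, None), the lower
black one (x, Some false) and the upper black one (x, Some true). *)
Definition mgraph_theta (f : M * option bool) : M * option bool :=
  match f with
  | (x, None) => (partner x, None)
  | (x, Some true) => (s x, Some false)
  | (x, Some false) => ((s^-1)%g x, Some true)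
  end.

Lemma mgraph_subproof :
  is_ctgraph mgraph_theta fst (fun f : M * option bool => f.2 == None).
Proof.
split.
- by case=> x [[]|] /=; rewrite ?permK ?permKV ?partnerK.
- by case=> x [[]|] /=; rewrite xpair_eqE ?andbF // andbT partner_free.
- by case=> x [[]|].
- move=> x; rewrite (@eq_card _ _ [predX pred1 x & predT]).
    by rewrite cardX card1 card_option card_bool.
  by case=> y o; rewrite !inE andbT.
- by move=> x; rewrite (@eq_card _ _ (pred1 (x, None))) ?card1.
Qed.

Definition mgraph : ctgraph := CTGraph mgraph_subproof.

Lemma mgraph_black_adj (x y : M) :
  @adj (black mgraph) x y = (y == s x) || (x == s y).
Proof.
apply/existsP/orP => [[[[z [[]|]] //= fb]]|].
- by move=> /andP[/eqP <- /eqP <-]; left.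
- by move=> /andP[/eqP <- /eqP <-]; right; rewrite permKV.
have bl b : ~~ @red mgraph (x, Some b) by [].
case=> /eqP e.
  by exists (Sub (x, Some true) (bl true)); rewrite /= e !eqxx.
by exists (Sub (x, Some false) (bl false)); rewrite /= e permK !eqxx.
Qed.

Lemma mgraph_adj (x y : M) :
  @adj mgraph x y = [|| y == partner x, y == s x | x == s y].
Proof.
rewrite -mgraph_black_adj; apply/existsP/orP.
  case=> -[z [b|]] /= /andP[/eqP <- /eqP <-]; last by left.
  right; apply/existsP.
  have bl : ~~ @red mgraph (z, Some b) by [].
  by exists (Sub (z, Some b) bl); rewrite /= !eqxx.
case=> [/eqP e|/existsP[[f fb] /=]].
  by exists (x, None); rewrite /= e !eqxx.
by exists f.
Qed.

Lemma components_black_mgraph : components (black mgraph) = porbits s.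
Proof.
suff H x : @component_of (black mgraph) x = porbit s x.
  rewrite componentsE; apply/setP => C.
  by apply/imsetP/imsetP => -[x _ ->]; exists x; rewrite ?inE ?H.
apply/setP => y; rewrite inE; apply/idP/porbitP => [/connectP[p + ->]|[i ->]].
  elim: p x => [|z p IH] x /=; first by exists 0%N; rewrite perm1.
  case/andP; rewrite mgraph_black_adj => xz /IH[i ->].
  apply/porbitP; rewrite -eq_porbit_mem porbit_perm.
  case/orP: xz => /eqP ->; rewrite eq_porbit_mem; last rewrite porbit_sym.
    exact: (mem_porbit s 1).
  exact: (mem_porbit s 1).
elim: i => [|i IH]; first by rewrite perm1.
apply: connect_trans IH (connect1 _).
by rewrite mgraph_black_adj expgSr permM eqxx.
Qed.

(** The sign of s is the parity of the number of points minus the number of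
cycles, that is, of the sum of (length - 1) over the cycles. *)
Lemma odd_perm_mgraph : odd_perm s = odd (num_even_cycles mgraph).
Proof.
rewrite /odd_perm /num_even_cycles components_black_mgraph.
have := components_partition (black mgraph); rewrite components_black_mgraph.
move=> part; rewrite -cardsT (card_partition part).
rewrite -sum1_card -[#|[set _ in _ | _]|]sum1_card.
rewrite !(big_morph odd oddD (erefl _)) -big_split /=.
rewrite big_mkcond [RHS]big_mkcond /=; apply: eq_bigr => C _.
by rewrite inE; case: (C \in _) => //=; case: (odd _).
Qed.

End MatchedGraph.

Definition equivariant (M M' : matching) (f : M -> M') : Prop :=
  forall x, f (partner x) = partner (f x).

Section Standard.
Variable n : nat.

(** The normal form ['I_n * bool] of a matched set makes its pairs and their two
ends explicit. *)
Definition std_partner (x : 'I_n * bool) : 'I_n * bool := (x.1, ~~ x.2).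

Lemma std_partnerK : involutive std_partner.
Proof. by case=> i b; rewrite /std_partner /= negbK. Qed.

Lemma std_partner_free x : std_partner x != x.
Proof. by case: x => i [] ; rewrite xpair_eqE andbF. Qed.

Definition std : matching := Matching std_partnerK std_partner_free.

Lemma card_std : #|std| = n.*2.
Proof. by rewrite card_prod card_ord card_bool muln2. Qed.

End Standard.

(** Of each pair take the element of smaller rank as its end [false]. *)
Lemma std_labelling (M : matching) n : #|M| = n.*2 ->
  exists2 f : std n -> M, bijective f & equivariant f.
Proof.
move=> cM; pose R := [set x : M | (enum_rank x < enum_rank (partner x))%N].
have RC x : (partner x \in R) = (x \notin R).
  rewrite !inE partnerK -leqNgt [RHS]leq_eqVlt.
  suff /negbTE -> : (enum_rank (partner x) : nat) != enum_rank x by [].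
  by rewrite (inj_eq val_inj) (inj_eq enum_rank_inj) partner_free.
have cR : #|R| = n.
  apply/eqP; rewrite -(eqn_pmul2l (isT : 0 < 2)%N) !mul2n -cM -addnn.
  rewrite -{2}(card_imset R (can_inj (@partnerK M))) -(cardsC R); apply/eqP.
  congr (_ + _)%N; apply: eq_card => x; rewrite [in RHS]inE -RC.
  by apply/imsetP/idP => [[y yR ->]|xR]; rewrite ?partnerK //;
     exists (partner x); rewrite ?partnerK.
pose e (i : 'I_n) : M := enum_val (cast_ord (esym cR) i).
have eR i : e i \in R by exact: enum_valP.
pose f (x : std n) : M := if x.2 then partner (e x.1) else e x.1.
have fR x : (f x \in R) = ~~ x.2 by rewrite /f; case: x.2; rewrite ?RC eR.
exists f; last by case=> i []; rewrite /f /= ?partnerK.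
apply: inj_card_bij; last by rewrite cM card_std.
move=> [i b] [j c] e1; have := fR (i, b); rewrite e1 fR => /negb_inj /= ecb.
move: e1; rewrite /f /= ecb => e1; congr (_, _).
have /enum_val_inj/cast_ord_inj -> // : e i = e j.
by case: (b) e1 => // /(can_inj (@partnerK M)).
Qed.

Lemma iso_mgraph_equivariant (M M' : matching) (f : M -> M')
    (s : {perm M}) (s' : {perm M'}) :
  equivariant f -> bijective f -> (forall x, s' (f x) = f (s x)) ->
  iso (mgraph s) (mgraph s').
Proof.
move=> f_equi fb fs; have [g fK gK] := fb.
have fsV x : (s'^-1)%g (f x) = f ((s^-1)%g x).
  by apply: (canLR (permK _)); rewrite fs permKV.
exists f, (fun u : M * option bool => (f u.1, u.2)); split=> //.
- by exists (fun u : M' * option bool => (g u.1, u.2)); case=> x o /=; rewrite ?fK ?gK.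
- by case=> x [[]|] /=; rewrite ?fs ?fsV ?f_equi.
Qed.

(** Two fixed-point free involutions generate a graph whose components are even
cycles, hence bipartite.  Here: the composite p = th o be satisfies
be p be = p^-1, so that be permutes the p-orbits, and a p-orbit mapped to itself
would contain, half-way between x and be x, a fixed point of be or th.  U takes
one orbit of each exchanged pair. *)
Lemma involutions_bipartite (F : finType) (th be : F -> F) :
  involutive th -> involutive be ->
  (forall x, th x != x) -> (forall x, be x != x) ->
  exists U : pred F, forall x, U (th x) = ~~ U x /\ U (be x) = ~~ U x.
Proof.
move=> thK beK th_free be_free; pose p x := th (be x).
have p_inj : injective p by apply: inj_comp; exact: can_inj.
have iter_inj k : injective (iter k p) by elim: k => //= k IH x y /p_inj/IH.
have pbp x : p (be (p x)) = be x by rewrite /p beK thK.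
have iterb m x : iter m p (be (iter m p x)) = be x.
  by elim: m => // m IH; rewrite iterSr [iter m.+1 p x]iterS pbp IH.
(* If p^k x = be x, then be fixes p^(k/2) x when k is even, and th fixes
   p^((k+1)/2) x when k is odd. *)
have noconn x : ~~ fconnect p x (be x).
  apply/negP => /iter_findex; move: (findex _ _ _) => k.
  rewrite -[k]odd_double_half -addnn; set m := k./2; rewrite addnA iterD.
  rewrite -[RHS](iterb m); case: (odd k); last first.
    by move/iter_inj/eqP; rewrite eq_sym (negbTE (be_free _)).
  rewrite add1n iterSr => /iter_inj/eqP.
  by rewrite (negbTE (th_free _)).
have csym := fconnect_sym p_inj.
have rootp x : froot p (p x) = froot p x.
  by apply/esym/eqP; rewrite root_connect //; exact: fconnect1.
have rootbe x : froot p (be (th x)) = froot p x by rewrite -rootp /p beK thK.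
have rootth x : froot p (th x) = froot p (be x).
  by rewrite -{1}[x]beK -/(p (be x)) rootp.
have asym (i j : 'I_#|F|) : i != j -> (j < i)%N = ~~ (i < j)%N.
  by move=> ij; rewrite ltn_neqAle eq_sym (inj_eq val_inj) ij /= leqNgt.
have rneq x : enum_rank (froot p x) != enum_rank (froot p (be x)).
  by rewrite (inj_eq enum_rank_inj) root_connect // noconn.
exists (fun x => enum_rank (froot p x) < enum_rank (froot p (be x)))%N => x.
by rewrite rootbe rootth beK asym.
Qed.

(** Apply the bipartition to the flags, with the edge involution and the
exchange of the two black flags at a vertex: calling one color upper and the
other lower, each vertex has one black flag of each kind, and each black edge
joins an upper flag to a lower one. *)
Lemma ctgraph_orientation (g : ctgraph) :
  exists (r : cvert g -> cvert g) (rK : involutive r) (rF : forall x, r x != x)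
    (s : {perm cvert g}), iso g (@mgraph (Matching rK rF) s).
Proof.
case: (ctgraphP g) => thK thF thC tri oner.
have /choice[rf rfP] : forall v, exists f : cflag g,
    [set f | (catt f == v) && red f] = [set f].
  by move=> v; apply/cards1P; rewrite cardsE; apply/eqP/oner.
have rfA v : catt (rf v) = v /\ red (rf v).
  by have := set11 (rf v); rewrite -rfP inE => /andP[/eqP].
have rfU f : red f -> f = rf (catt f).
  by move=> rd; apply/set1P; rewrite -rfP inE eqxx.
have /choice[a] : forall v, exists a b : cflag g, a != b /\
    [set f | (catt f == v) && ~~ red f] = [set a; b].
  move=> v; apply/cards2P; rewrite cardsE.
  apply/eqP/(@addnI 1); rewrite -[RHS](tri v).
  rewrite -[RHS](cardID (@red g)); congr (_ + _)%N; last first.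
    by apply: eq_card => f; rewrite !inE andbC.
  by rewrite -[LHS](oner v); apply: eq_card => f; rewrite !inE andbC.
move=> /choice[b abP].
have aP v : catt (a v) = v /\ red (a v) = false.
  have [_ e] := abP v; have := set21 (a v) (b v).
  by rewrite -e inE => /andP[/eqP ? /negbTE].
have bP v : catt (b v) = v /\ red (b v) = false.
  have [_ e] := abP v; have := set22 (a v) (b v).
  by rewrite -e inE => /andP[/eqP ? /negbTE].
have ab v : a v != b v by case: (abP v).
have abU f : red f = false -> f = a (catt f) \/ f = b (catt f).
  move=> nr; have [_ e] := abP (catt f); apply/set2P.
  by rewrite -e inE eqxx nr.
(* The red flags only need some involution without fixed points. *)
pose be f := if red f then ctheta f else
  if f == a (catt f) then b (catt f) else a (catt f).
have beK : involutive be.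
  move=> f; rewrite /be; case: (boolP (red f)) => [rd|/negbTE nr].
    by rewrite thC rd thK.
  case: eqP => [fa|fna].
    by rewrite (bP _).2 (bP _).1 eq_sym (negbTE (ab _)).
  by rewrite (aP _).2 (aP _).1 eqxx; case: (abU f nr).
have beF f : be f != f.
  rewrite /be; case: (boolP (red f)) => [rd|/negbTE nr]; first exact: thF.
  by case: (f =P a _) => [fa|fna]; [rewrite {2}fa eq_sym ab|apply/eqP => /esym].
have [U UP] := involutions_bipartite thK beK thF beF.
have Ub v : U (b v) = ~~ U (a v).
  by have [_ <-] := UP (a v); rewrite /be (aP _).2 (aP _).1 eqxx.
pose up v := if U (a v) then a v else b v.
pose lo v := if U (a v) then b v else a v.
have upP v : [/\ catt (up v) = v, red (up v) = false & U (up v)].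
  by rewrite /up; case: ifP => Ua;
    rewrite ?Ub ?Ua ?(aP _).1 ?(aP _).2 ?(bP _).1 ?(bP _).2.
have loP v : [/\ catt (lo v) = v, red (lo v) = false & U (lo v) = false].
  by rewrite /lo; case: ifP => Ua;
    rewrite ?Ub ?Ua ?(aP _).1 ?(aP _).2 ?(bP _).1 ?(bP _).2.
have upU f : red f = false -> U f -> f = up (catt f).
  move=> /abU; rewrite /up; case=> {1 2}->; first by move=> ->.
  by rewrite Ub => /negbTE ->.
have loU f : red f = false -> U f = false -> f = lo (catt f).
  move=> /abU; rewrite /lo; case=> {1 2}->; first by move=> ->.
  by rewrite Ub => /negbFE ->.
pose sf v := catt (ctheta (up v)).
have sfE v : ctheta (up v) = lo (sf v).
  have [_ nr Uu] := upP v; apply: loU; first by rewrite thC.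
  by have [-> _] := UP (up v); rewrite Uu.
have sf_inj : injective sf.
  move=> v w e; have /(can_inj thK) euv : ctheta (up v) = ctheta (up w) by rewrite !sfE e.
  by move: (congr1 (@catt g) euv); case: (upP v) => -> _ _; case: (upP w) => ->.
pose s := perm sf_inj.
have sfVE v : ctheta (lo v) = up ((s^-1)%g v).
  by rewrite -{1}(permKV s v) permE -sfE thK.
pose r v := catt (ctheta (rf v)).
have rE v : ctheta (rf v) = rf (r v) by apply: rfU; rewrite thC (rfA v).2.
have rK : involutive r by move=> v; rewrite {1}/r -rE thK (rfA v).1.
have rF v : r v != v.
  apply/eqP => e; have := thF (rf v); by rewrite rE e eqxx.
exists r, rK, rF, s; apply: iso_sym.
pose ff (u : cvert g * option bool) : cflag g := match u with
  | (v, None) => rf v | (v, Some true) => up v | (v, Some false) => lo v end.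
have ffv u : catt (ff u) = u.1.
  by case: u => v [[]|] /=; [case: (upP v)|case: (loP v)|case: (rfA v)].
have ffr u : red (ff u) = (u.2 == None).
  by case: u => v [[]|] /=; [case: (upP v)|case: (loP v)|case: (rfA v)].
exists id, ff; split=> //; first by exists id.
- apply: inj_card_bij => [u u' e|]; last first.
    by rewrite card_flag card_prod card_option card_bool.
  have e1 : u.1 = u'.1 by rewrite -!ffv e.
  have e2 : (u.2 == None) = (u'.2 == None) by rewrite -!ffr e.
  case: u u' e e1 e2 => v o [w o'] /= + ew; subst w.
  have [_ _ Uu] := upP v; have [_ _ Ul] := loP v.
  by case: o o' => [[]|] [[]|] //= e _; move: Uu; rewrite ?e ?Ul // -e Ul.
- by case=> v [[]|] //=; rewrite ?sfE ?sfVE ?rE ?permE.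
Qed.

Lemma ctgraph_std (g : ctgraph) n : #|cvert g| = n.*2 ->
  exists s : {perm std n}, iso g (mgraph s).
Proof.
have [r [rK [rF [s gs]]]] := ctgraph_orientation g => cg.
have [f [f' fK f'K] fe] := @std_labelling (Matching rK rF) n cg.
have f'i := can_inj f'K; exists (perm_ext f'i s).
apply: iso_trans gs (iso_mgraph_equivariant (f := f') _ _ _).
- by move=> x; apply: (can_inj fK); rewrite fe !f'K.
- by exists f.
- exact: perm_extE.
Qed.

(** * Counting the permutations with a given graph *)

(** At each x, the neighbours of x along s and along t agree as multisets, so
that the cycles of s and t form the same graph once their orientation is
forgotten. *)
Definition same_edges (T : finType) (s t : {perm T}) : bool :=
  [forall x, (s x == t x) && ((s^-1)%g x == (t^-1)%g x)
          || (s x == (t^-1)%g x) && ((s^-1)%g x == t x)].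

Lemma same_edgesP (T : finType) (s t : {perm T}) :
  reflect (forall x, s x = t x /\ (s^-1)%g x = (t^-1)%g x \/
                     s x = (t^-1)%g x /\ (s^-1)%g x = t x)
          (same_edges s t).
Proof.
apply: (iffP forallP) => H x.
  by case/orP: (H x) => /andP[/eqP ? /eqP ?]; [left|right].
by apply/orP; case: (H x) => -[-> ->]; [left|right]; rewrite !eqxx.
Qed.

Section Flip.
Variables (T : finType) (s t : {perm T}).
Hypothesis st : same_edges s t.

(** If s and t agree at x they leave x for the same point, where their inverses
then agree, and therefore also s and t. *)
Lemma same_edges_flip x : (s (s x) == t (s x)) = (s x == t x).
Proof.
apply/eqP/eqP => e.
  have : (s^-1)%g (s x) = (t^-1)%g (s x).
    by case/same_edgesP/(_ (s x)): st => -[] // e1 e2; rewrite e2 -e e1.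
  by rewrite permK => {2}->; rewrite permKV.
case/same_edgesP/(_ (s x)): st => -[] // -> <-.
by rewrite permK {1}e permK.
Qed.

Lemma same_edges_porbit x y :
  y \in porbit s x -> (s y == t y) = (s x == t x).
Proof.
case/porbitP => i ->; elim: i => [|i IH]; first by rewrite perm1.
by rewrite expgSr permM same_edges_flip.
Qed.

End Flip.

(** Which vertex permutations come from isomorphisms: the flags can be mapped
accordingly by exchanging the upper and the lower flag along the cycles on which
the two orientations differ. *)
Lemma iso_mgraph_perm (M : matching) (s t p : {perm M}) :
  (exists ff, @is_iso (mgraph s) (mgraph t) p ff) <->
  (forall x, p (partner x) = partner (p x)) /\ same_edges (s ^ p)%g t.
Proof.
have sJ x : (s ^ p)%g (p x) = p (s x) by rewrite permJ.
have sJV x : ((s ^ p)^-1)%g (p x) = p ((s^-1)%g x) by rewrite -conjVg permJ.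
split=> [[ff [_ /bij_inj ffi ht ha hr]]|[pe st]].
  have [fo ffE] : exists fo, forall x o, ff (x, o) = (p x, fo x o).
    exists (fun x o => (ff (x, o)).2) => x o.
    by have := ha (x, o); case: (ff (x, o)) => y o' /= ->.
  have ffN x : ff (x, None) = (p x, None).
    by have := hr (x, None); rewrite ffE /= => /eqP e; rewrite e.
  split=> [x|].
    by have := ht (x, None); rewrite /= !ffN /= => -[].
  apply/same_edgesP => y; rewrite -[y](permKV p); move: (p^-1 y)%g => {}x.
  rewrite sJ sJV.
  have h1 := ht (x, Some true); have h0 := ht (x, Some false).
  have := ffi (x, Some true) (x, Some false).
  have := hr (x, Some false); have := hr (x, Some true).
  move: h1 h0; rewrite /= !ffE /=.
  case: (fo x (Some true)) => [[]|] //=;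
  case: (fo x (Some false)) => [[]|] //= [e1 _] [e2 _] _ _.
  - by move/(_ erefl).
  - by left.
  - by right.
  - by move/(_ erefl).
pose fl y := (s ^ p)%g y != t y.
have flip x : fl (p (s x)) = fl (p x).
  by rewrite /fl -sJ same_edges_flip.
have flipV x : fl (p ((s^-1)%g x)) = fl (p x) by rewrite -flip permKV.
pose fo y (o : option bool) := if o is Some b then Some (b (+) fl y) else None.
have foK y : involutive (fo y) by case=> [b|] //=; rewrite -addbA addbb addbF.
exists (fun u => (p u.1, fo (p u.1) u.2)); split=> //.
- by exists p^-1%g => x; rewrite ?permK ?permKV.
- exists (fun u => ((p^-1)%g u.1, fo u.1 u.2)) => -[x o] /=.
    by rewrite permK foK.
  by rewrite permKV foK.
- case=> x [[]|] /=; last by rewrite pe.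
    rewrite flip -sJ.
    case: (same_edgesP _ _ st (p x)); rewrite /fl /= => -[e1 e2].
      by rewrite e1 eqxx.
    case: eqP => [e|_] /=; first by rewrite e.
    by rewrite e1.
  rewrite flipV -sJV.
  case: (same_edgesP _ _ st (p x)); rewrite /fl /= => -[e1 e2].
    by rewrite e1 e2 eqxx.
  case: eqP => [e|_] /=; last by rewrite e2.
  by rewrite e2 -e e1.
- by case=> x [].
Qed.

Lemma same_edges_sym (T : finType) (s t : {perm T}) :
  same_edges s t = same_edges t s.
Proof.
by apply/same_edgesP/same_edgesP => H x; case: (H x) => -[-> ->]; auto.
Qed.

Lemma porbit_le2 (T : finType) (s : {perm T}) (x : T) :
  (#|porbit s x| <= 2)%N = (s x == (s^-1)%g x).
Proof.
have := iter_porbit s x; have := card_porbit_neq0 s x.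
have := uniq_traject_porbit s x.
case: #|porbit s x| => [|[|[|k]]] //= uniq_tr _ ss.
- by apply/esym/eqP; rewrite ss -{2}ss permK.
- by apply/esym/eqP; rewrite -{2}ss permK.
- apply/esym/negbTE/eqP => sx; move: uniq_tr.
  by rewrite {2}sx permKV !inE eqxx !orbT.
Qed.

Section CountOrientations.
Variables (T : finType) (s : {perm T}).

(** Reversal of the cycles that belong to D, and the inverse permutation. *)
Let flip_fun (D : {set {set T}}) (x : T) : T :=
  if porbit s x \in D then (s^-1)%g x else s x.

Let flip_inv (D : {set {set T}}) (x : T) : T :=
  if porbit s x \in D then s x else (s^-1)%g x.

Let porbit_s x : porbit s (s x) = porbit s x.
Proof. by rewrite -(porbit_perm s 1 x). Qed.

Let porbit_sV x : porbit s ((s^-1)%g x) = porbit s x.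
Proof. by rewrite -{2}(permKV s x) porbit_s. Qed.

Let flipK D : cancel (flip_fun D) (flip_inv D).
Proof.
move=> x; rewrite /flip_fun; case: ifP => xD.
  by rewrite /flip_inv porbit_sV xD permKV.
by rewrite /flip_inv porbit_s xD permK.
Qed.

Let flip_perm D : {perm T} := perm (can_inj (flipK D)).

Let flip_permV D x : ((flip_perm D)^-1)%g x = flip_inv D x.
Proof.
apply: (@perm_inj _ (flip_perm D)); rewrite permKV permE.
rewrite /flip_inv; case: ifP => xD.
  by rewrite /flip_fun porbit_s xD permK.
by rewrite /flip_fun porbit_sV xD permKV.
Qed.

(** A permutation with the same edges as s agrees on each cycle with s or with
its inverse, and these two differ exactly on the cycles of length greater
than 2. *)
Lemma card_same_edges :
  #|[set t | same_edges s t]| = (2 ^ #|[set C in porbits s | (2 < #|C|)%N]|)%N.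
Proof.
set L := [set C in porbits s | _].
rewrite -card_powerset -(card_in_imset (f := flip_perm)); last first.
  have sub D D' : D \in powerset L -> flip_perm D = flip_perm D' -> D \subset D'.
    rewrite powersetE => /subsetP DL eD; apply/subsetP => C CD.
    have := DL _ CD; rewrite inE => /andP[/imsetP[x _ eC]].
    rewrite eC ltnNge porbit_le2 => nx.
    have := congr1 (fun t : {perm T} => t x) eD.
    rewrite !permE /flip_fun -eC CD; case: ifP => // _ e.
    by rewrite e eqxx in nx.
  by move=> D D' DL D'L e; apply/eqP; rewrite eqEsubset !sub.
apply: eq_card => t; rewrite inE; apply/idP/imsetP => [st|[D DL ->]]; last first.
  apply/same_edgesP => x; rewrite flip_permV permE /flip_fun /flip_inv.
  by case: ifP; auto.
(* The long cycles on which t is not s, hence is its inverse. *)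
exists [set C in L | [exists x in C, s x != t x]].
  by rewrite powersetE; apply/subsetP => C; rewrite inE => /andP[].
apply/permP => x; rewrite permE /flip_fun inE.
have tx : t x = s x \/ t x = (s^-1)%g x.
  by case/same_edgesP/(_ x): st => -[-> ->]; auto.
case: (boolP (_ && _)) => [/andP[_ /existsP[y /andP[yx]]]|].
  by rewrite (same_edges_porbit st yx); case: tx => -> //; rewrite eqxx.
rewrite negb_and => /orP[|/existsPn/(_ x)]; last first.
  by rewrite porbit_id negbK => /eqP.
rewrite inE imset_f //= -leqNgt porbit_le2 => /eqP e.
by case: tx => ->.
Qed.

End CountOrientations.

Section CountLabellings.
Variable n : nat.

Definition equivariant_perms : {set {perm std n}} :=
  [set p : {perm std n} | [forall x, p (partner x) == partner (p x)]].

Lemma equivariant_permsP (p : {perm std n}) :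
  reflect (equivariant p) (p \in equivariant_perms).
Proof. by rewrite inE; apply: (iffP forallP) => H x; apply/eqP. Qed.

(** These permutations permute the n pairs and may exchange the two ends of each
of them: they form the hyperoctahedral group. *)
Lemma card_equivariant_perms : #|equivariant_perms| = (2 ^ n * n`!)%N.
Proof.
pose f (qc : {perm 'I_n} * {ffun 'I_n -> bool}) (x : std n) : std n :=
  (qc.1 x.1, x.2 (+) qc.2 x.1).
have f_inj qc : injective (f qc).
  move=> [i b] [j c] [/perm_inj <- e]; congr (_, _).
  by move: e => /=; case: (qc.2 i); case: b; case: c.
pose F qc := perm (f_inj qc).
have FE qc x : F qc x = f qc x by rewrite permE.
have F_inj : injective F.
  move=> [q c] [q' c'] e; congr (_, _).
    apply/permP => i; have := congr1 (fun p : {perm _} => (p (i, false)).1) e.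
    by rewrite !FE.
  apply/ffunP => i; have := congr1 (fun p : {perm _} => (p (i, false)).2) e.
  by rewrite !FE.
rewrite (_ : equivariant_perms = F @: [set: _]).
  by rewrite card_imset // cardsT card_prod card_Sn card_ffun card_bool card_ord mulnC.
apply/setP => p; apply/equivariant_permsP/imsetP => [pe|[qc _ ->]]; last first.
  by move=> [i b]; rewrite !FE /f /partner /= /std_partner /= addNb.
have q_inj : injective (fun i => (p (i, false)).1).
  move=> i j /= e; case: (eqVneq (p (i, false)).2 (p (j, false)).2) => e2.
    have /perm_inj[] // : p (i, false) = p (j, false).
    by rewrite [LHS]surjective_pairing [RHS]surjective_pairing e e2.
  have /perm_inj[] // : p (i, true) = p (j, false).
  rewrite -[(i, true)]/(partner ((i, false) : std n)) pe.
  rewrite [RHS]surjective_pairing /= /std_partner e.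
  by move: e2; do 2 case: (_.2).
exists (perm q_inj, [ffun i => (p (i, false)).2]) => //.
apply/permP => -[i b]; rewrite FE /f /= permE ffunE.
case: b; last by rewrite addFb -surjective_pairing.
by rewrite -[(i, true)]/(partner ((i, false) : std n)) pe.
Qed.

(** Double counting of the pairs (s, p) such that the permutation p of the
vertices is induced by an isomorphism from the graph of s to that of s0: for
given s the p form a coset of the group of s0, and for given p the conjugates
s^p are the permutations with the same edges as s0. *)
Lemma count_mgraph_iso (s0 : {perm std n}) :
  (#|[set s : {perm std n} | `[< iso (mgraph s) (mgraph s0) >]]|
    * #|autbar (mgraph s0)|
   = 2 ^ n * n`! * 2 ^ num_long_cycles (mgraph s0))%N.
Proof.
pose I (s p : {perm std n}) := (p \in equivariant_perms) && same_edges (s ^ p)%g s0.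
have IP (s p : {perm std n}) :
    reflect (exists ff, @is_iso (mgraph s) (mgraph s0) p ff) (I s p).
  apply: (iffP andP) => [[/equivariant_permsP pe st]|].
    exact/iso_mgraph_perm.
  by move/iso_mgraph_perm => [/equivariant_permsP].
have fib s : #|[set p | I s p]| =
    if `[< iso (mgraph s) (mgraph s0) >] then #|autbar (mgraph s0)| else 0%N.
  case: asboolP => [[fv [ff fiso]]|niso]; last first.
    apply: eq_card0 => p; rewrite inE; apply/negP => /IP[ff fiso].
    by apply: niso; exists p, ff.
  have [fvb _ _ _ _] := fiso; pose p0 := perm (bij_inj fvb).
  have p0E : fun_of_perm p0 = fv by apply/funext => x; rewrite permE.
  rewrite -[RHS](card_imset _ (@mulgI _ p0)); apply: eq_card => p; rewrite inE.
  have {}fiso : @is_iso (mgraph s) (mgraph s0) p0 ff by rewrite p0E.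
  have [_ [gg ffK _] _ _ _] := fiso.
  apply/IP/imsetP => [[ff' fiso']|[a + ->]].
    exists (p0^-1 * p)%g; last by rewrite mulKVg.
    rewrite inE; apply/asboolP; exists (ff' \o gg).
    rewrite (_ : fun_of_perm _ = p \o (p0^-1)%g); last first.
      by apply/funext => x; rewrite permM.
    apply: is_iso_comp fiso'; apply: is_iso_inv fiso _ ffK; exact: permK.
  rewrite inE => /asboolP[fa aiso]; exists (fa \o ff).
  rewrite (_ : fun_of_perm _ = a \o p0); first exact: is_iso_comp aiso.
  by apply/funext => x; rewrite permM.
transitivity (\sum_s #|[set p | I s p]|)%N.
  rewrite (eq_bigr _ (fun s _ => fib s)) -big_mkcond sum_nat_const.
  by congr (_ * _)%N; apply: eq_card => s; rewrite inE.
transitivity (\sum_(p in equivariant_perms) #|[set t | same_edges s0 t]|)%N.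
  under eq_bigr do rewrite -sum1_card.
  rewrite (exchange_big_dep (fun p => p \in equivariant_perms)) /=; last first.
    by move=> s p _; rewrite inE => /andP[].
  apply: eq_bigr => p pe; rewrite sum1_card.
  rewrite -[RHS](card_imset _ (conjg_inj p^-1%g)); apply: eq_card => s.
  transitivity (p \in [set p0 | I s p0]) => //; rewrite inE /I pe /=.
  apply/idP/imsetP => [st|[t + ->]].
    by exists (s ^ p)%g; rewrite ?inE 1?same_edges_sym // conjgK.
  by rewrite inE conjgKV same_edges_sym.
rewrite sum_nat_const card_equivariant_perms card_same_edges.
by rewrite /num_long_cycles components_black_mgraph.
Qed.

End CountLabellings.

(** * Splitting off a component *)
Lemma adj_component (G : graph) (C : {set vert G}) (x y : vert G) :
  C \in components G -> adj x y -> (y \in C) = (x \in C).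
Proof.
move=> CG; suff H (u v : vert G) : adj u v -> u \in C -> v \in C.
  by move=> xy; apply/idP/idP; apply: H => //; rewrite adj_sym.
by move=> uv uC; rewrite (component_of_eq CG uC) inE connect1.
Qed.

Section Sub.
Variables (M : matching) (C : {set M}).

Definition partner_closed : Prop := forall x, (partner x \in C) = (x \in C).

Hypothesis Cclosed : partner_closed.

Definition sub_partner (x : {x | x \in C}) : {x | x \in C} :=
  Sub (partner (val x)) (etrans (Cclosed _) (valP x)).

Lemma sub_partnerK : involutive sub_partner.
Proof. by move=> x; apply: val_inj; rewrite /= partnerK. Qed.

Lemma sub_partner_free x : sub_partner x != x.
Proof. by rewrite -val_eqE partner_free. Qed.

Definition sub_matching : matching := Matching sub_partnerK sub_partner_free.

End Sub.

Lemma partner_closedC (M : matching) (C : {set M}) :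
  partner_closed C -> partner_closed (~: C).
Proof. by move=> CC x; rewrite !inE CC. Qed.

Lemma perm_restrict (T : finType) (C : {set T}) (s : {perm T}) :
  (forall x, x \in C -> s x \in C) ->
  exists s1 : {perm {x | x \in C}}, forall x, val (s1 x) = s (val x).
Proof.
move=> sC; pose f (x : {x | x \in C}) : {x | x \in C} := Sub (s (val x)) (sC _ (valP x)).
have f_inj : injective f by move=> x y /(congr1 val)/= /perm_inj/val_inj.
by exists (perm f_inj) => x; rewrite permE.
Qed.

Section Split.
Variables (M : matching) (C : {set M}).
Hypothesis Cclosed : partner_closed C.
Let M1 := sub_matching Cclosed.
Let M2 := sub_matching (partner_closedC Cclosed).
Variables (s1 : {perm M1}) (s2 : {perm M2}).

(** The permutations that stabilize C are those of this form. *)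
Definition perm_join : {perm M} :=
  (perm_ext (@val_inj _ _ M1) s1 * perm_ext (@val_inj _ _ M2) s2)%g.

Lemma perm_joinl (x : M1) : perm_join (val x) = val (s1 x).
Proof.
rewrite permM perm_extE perm_ext_out // => y.
by apply: contraTneq (valP (s1 x)) => <-; have := valP y; rewrite inE.
Qed.

Lemma perm_joinr (x : M2) : perm_join (val x) = val (s2 x).
Proof.
rewrite permM (perm_ext_out _ s1) ?perm_extE // => y.
by apply: contraTneq (valP x) => <-; have := valP y; rewrite inE => ->.
Qed.

Lemma perm_joinVl (x : M1) : (perm_join^-1)%g (val x) = val ((s1^-1)%g x).
Proof. by apply: (canLR (permK _)); rewrite perm_joinl permKV. Qed.

Lemma perm_joinVr (x : M2) : (perm_join^-1)%g (val x) = val ((s2^-1)%g x).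
Proof. by apply: (canLR (permK _)); rewrite perm_joinr permKV. Qed.

Lemma odd_perm_join : odd_perm perm_join = odd_perm s1 (+) odd_perm s2.
Proof. by rewrite odd_permM !odd_perm_ext. Qed.

Lemma mgraph_join :
  iso (disjoint_union (mgraph s1) (mgraph s2)) (mgraph perm_join).
Proof.
pose fv (x : M1 + M2) : M := match x with inl x => val x | inr x => val x end.
pose ff (u : M1 * option bool + M2 * option bool) : M * option bool :=
  match u with inl u => (val u.1, u.2) | inr u => (val u.1, u.2) end.
have ne (x : M1) (y : M2) : val x <> val y.
  by move=> e; have := valP y; rewrite -e inE (valP x).
have cM : #|M| = (#|M1| + #|M2|)%N.
  rewrite !card_sig -(cardC (mem C)); congr (_ + _)%N.
  by apply: eq_card => x; rewrite !inE.
exists fv, ff; split.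
- apply: inj_card_bij; last by rewrite /= card_sum cM.
  case=> x [] y /=; do ?by move/val_inj->.
    by move/ne.
  by move/esym/ne.
- apply: inj_card_bij; last by rewrite !card_flag /= card_sum cM.
  case=> -[x a] [] [y b] [] /=; do ?by move/val_inj-> => ->.
    by move/ne.
  by move/esym/ne.
- case=> -[x [[]|]] //=; rewrite ?perm_joinl ?perm_joinr //.
    by rewrite perm_joinVl.
  by rewrite perm_joinVr.
- by case.
- by case.
Qed.

Lemma val_open_embedding :
  @open_embedding (mgraph s1) (mgraph perm_join) (val : M1 -> M).
Proof.
split; first exact: val_inj.
  move=> x y; rewrite !mgraph_adj !perm_joinl.
  by rewrite -[partner (val x)]/(val (partner x)) !(inj_eq val_inj).
move=> x z; rewrite mgraph_adj => /or3P[] /eqP.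
- by move=> ->; exists (partner x).
- by rewrite perm_joinl => ->; exists (s1 x).
- by move/(canLR (permK _)) => <-; rewrite perm_joinVl; exists ((s1^-1)%g x).
Qed.

Lemma component_join :
  (C \in components (mgraph perm_join)) = connected (mgraph s1).
Proof.
have CE : val @: [set: M1] = C.
  apply/setP => z; apply/imsetP/idP => [[x _ ->]|zC]; first exact: valP.
  by exists (Sub z zC).
rewrite connectedE; apply/idP/idP => [CG|].
  have [x xC] : exists x, x \in C.
    move: (CG); rewrite componentsE => /imsetP[x _ ->]; exists x.
    by rewrite inE connect0.
  have := component_of_eq CG xC; rewrite -{1}CE.
  rewrite -[x]/(val (Sub x xC : M1)) (component_of_embedding _ val_open_embedding).
  by move/(imset_inj val_inj) => ->; exact: component_of_in.
move=> TG; move: (TG); rewrite componentsE => /imsetP[x _ eT].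
have := @component_of_in (mgraph perm_join) (val x).
by rewrite (component_of_embedding _ val_open_embedding) -eT CE.
Qed.

End Split.

Section SignedSums.
Variable R : realType.
Local Notation A := {malg R[ctclass]}.

Definition signed_term (M : matching) (s : {perm M}) : A :=
  (-1) ^+ s *: << class_of (mgraph s) >>.

Definition signed_sum (M : matching) : A := \sum_(s : {perm M}) signed_term s.

Definition signed_sum_conn (M : matching) : A :=
  \sum_(s : {perm M} | connected (mgraph s)) signed_term s.

Section Transport.
Variables (M M' : matching) (f : M -> M').
Hypotheses (f_bij : bijective f) (f_equi : equivariant f).
Let f_inj := bij_inj f_bij.

Let iso_ext (s : {perm M}) : iso (mgraph s) (mgraph (perm_ext f_inj s)).
Proof. by apply: (iso_mgraph_equivariant f_equi) => // x; rewrite perm_extE. Qed.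

Lemma perm_ext_bij : bijective (perm_ext f_inj).
Proof.
case: (f_bij) => g fK gK; have g_inj := can_inj gK.
exists (perm_ext g_inj) => s; apply/permP => x.
  by rewrite -{1}(fK x) perm_extE perm_extE fK.
by rewrite -{1}(gK x) perm_extE perm_extE gK.
Qed.

(** An equivariant bijection identifies the permutations of both sides,
preserving the sign and the isomorphism class of the graph. *)
Lemma sum_signed_term_bij (P : pred {perm M}) (P' : pred {perm M'}) :
  (forall s, P' (perm_ext f_inj s) = P s) ->
  \sum_(s | P' s) signed_term s = \sum_(s | P s) signed_term s.
Proof.
move=> PP'; rewrite (reindex (perm_ext f_inj)) /=; last exact/onW_bij/perm_ext_bij.
apply: eq_big => s; first exact: PP'.
move=> _; rewrite /signed_term odd_perm_ext; congr (_ *: << _ >>).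
exact/ctclassP/iso_sym.
Qed.

Lemma signed_sum_bij : signed_sum M' = signed_sum M.
Proof. exact: sum_signed_term_bij. Qed.

Lemma signed_sum_conn_bij : signed_sum_conn M' = signed_sum_conn M.
Proof. by apply: sum_signed_term_bij => s; apply/esym/iso_connected. Qed.

End Transport.

Lemma signed_sum_std (M : matching) n : #|M| = n.*2 -> signed_sum M = signed_sum (std n).
Proof. by case/std_labelling => f fb fe; exact: signed_sum_bij fb fe. Qed.

Lemma signed_sum_conn_std (M : matching) n :
  #|M| = n.*2 -> signed_sum_conn M = signed_sum_conn (std n).
Proof. by case/std_labelling => f fb fe; exact: signed_sum_conn_bij fb fe. Qed.

(** The permutations with C as a component of their graph are the joins of a
permutation of C with connected graph and any permutation of the complement; the
sign and the class of the graph are multiplicative under joins. *)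
Lemma sum_component (M : matching) (C : {set M}) (CC : partner_closed C) :
  \sum_(s : {perm M} | C \in components (mgraph s)) signed_term s =
  signed_sum_conn (sub_matching CC) * signed_sum (sub_matching (partner_closedC CC)).
Proof.
set M1 := sub_matching CC; set M2 := sub_matching (partner_closedC CC).
pose J (ss : {perm M1} * {perm M2}) := perm_join ss.1 ss.2.
have J_inj : injective J.
  move=> [s1 s2] [t1 t2] /= e; congr (_, _); apply/permP => x; apply: val_inj.
    by rewrite -[LHS](perm_joinl s1 s2) -[RHS](perm_joinl t1 t2)
               -[perm_join s1 s2]/(J (s1, s2)) e.
  by rewrite -[LHS](perm_joinr s1 s2) -[RHS](perm_joinr t1 t2)
               -[perm_join s1 s2]/(J (s1, s2)) e.
transitivity (\sum_(s in J @: [set ss | connected (mgraph ss.1)]) signed_term s).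
  apply: eq_bigl => s; apply/idP/imsetP => [Cs|[[s1 s2]]]; last first.
    by rewrite inE => c1 ->; rewrite component_join.
  have sC x : (s x \in C) = (x \in C).
    by apply: (adj_component Cs); rewrite mgraph_adj eqxx orbT.
  have [s1 s1E] : exists s1 : {perm M1}, forall x, val (s1 x) = s (val x).
    by apply: perm_restrict => x; rewrite sC.
  have [s2 s2E] : exists s2 : {perm M2}, forall x, val (s2 x) = s (val x).
    by apply: perm_restrict => x; rewrite !inE sC.
  have es : s = perm_join s1 s2.
    apply/permP => x; case: (boolP (x \in C)) => xC.
      by rewrite -[x]/(val (Sub x xC : M1)) perm_joinl s1E.
    have xC' : x \in ~: C by rewrite inE.
    by rewrite -[x]/(val (Sub x xC' : M2)) perm_joinr s2E.
  exists (s1, s2) => //; rewrite inE /=.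
  by rewrite -(component_join s1 s2) -es.
rewrite big_imset /=; last by move=> ? ? _ _; exact: J_inj.
rewrite /signed_sum_conn /signed_sum big_distrlr pair_big /=.
apply: eq_big => [ss|[s1 s2] _ /=]; first by rewrite inE andbT.
rewrite /signed_term odd_perm_join signr_addb.
rewrite -scalerAl -scalerAr scalerA.
rewrite malgM_def fgmulUU mulr1; congr (_ *: << _ >>).
by rewrite -[RHS]/(ctclassM _ _) ctclassME; apply/ctclassP/iso_sym/mgraph_join.
Qed.

End SignedSums.

Section Recursion.
Variable R : realType.

(** The sets of points that are closed under the matching are those of this
form; in particular a component is. *)
Definition pairs_over n (D : {set 'I_n}) : {set std n} := setX D [set: bool].

Lemma pairs_over_closed n (D : {set 'I_n}) : partner_closed (pairs_over D).
Proof. by move=> [i b]; rewrite !inE. Qed.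

Lemma card_pairs_over n (D : {set 'I_n}) : #|pairs_over D| = #|D|.*2.
Proof. by rewrite cardsX cardsT card_bool muln2. Qed.

Lemma pairs_over_inj n : injective (@pairs_over n).
Proof.
move=> D D' e; apply/setP => i.
by have /setP/(_ (i, true)) := e; rewrite !inE /= !andbT.
Qed.

Lemma component_pairs_over n (s : {perm std n}) (C : {set std n}) :
  C \in components (mgraph s) -> exists D, C = pairs_over D.
Proof.
move=> CG; exists [set i | (i, true) \in C]; apply/setP => -[i b].
rewrite !inE andbT; case: b => //.
apply/esym; apply: (@adj_component (mgraph s) C (i, false) (i, true) CG).
by rewrite mgraph_adj [(i, true) == _]eqxx.
Qed.

(** In each term replace the number of points by the sum of the sizes of the
components, and exchange the sums: the contribution of a component depends only
on its number k of pairs, which can be chosen in binomial(n, k) ways. *)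
Lemma signed_sum_recursion n :
  n%:R *: signed_sum R (std n) =
  \sum_(k < n.+1) (k * 'C(n, k))%:R *:
    (signed_sum_conn R (std k) * signed_sum R (std (n - k))).
Proof.
(* Points come in pairs: count the 2n points rather than the n pairs. *)
have two_neq0 : 2%:R != 0 :> R by rewrite pnatr_eq0.
apply: (scalerI two_neq0); rewrite scalerA -natrM mul2n -[n.*2]card_std -cardsT.
pose B := [set pairs_over D | D in [set: {set 'I_n}]].
transitivity (\sum_(C in B)
    \sum_(s : {perm std n} | (C : {set vert (mgraph s)}) \in components (mgraph s))
    #|(C : {set std n})|%:R *: signed_term R s).
  rewrite (exchange_big_dep predT) //= scaler_sumr; apply: eq_bigr => s _.
  rewrite (card_partition (components_partition (mgraph s))) natr_sum scaler_suml.
  apply: eq_bigl => C; rewrite andbC; apply/idP/andP => [CG|[]//].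
  split=> //; have [D ->] := component_pairs_over CG.
  by rewrite imset_f ?inE.
rewrite big_imset /=; last by move=> ? ? _ _; exact: pairs_over_inj.
pose F k := (2 * k)%:R *: (signed_sum_conn R (std k) * signed_sum R (std (n - k))).
transitivity (\sum_(D : {set 'I_n}) F #|D|).
  apply: eq_big => [D|D _]; first by rewrite inE.
  rewrite -scaler_sumr card_pairs_over /F mul2n (sum_component _ (pairs_over_closed D)).
  congr (_ *: (_ * _)); [apply: signed_sum_conn_std|apply: signed_sum_std].
    by rewrite card_sig -card_pairs_over.
  rewrite card_sig -[LHS]/#|~: pairs_over D|.
  by rewrite cardsCs setCK card_pairs_over card_std doubleB.
rewrite (partition_big (fun D : {set 'I_n} => inord #|D| : 'I_n.+1) predT) //=.
rewrite scaler_sumr; apply: eq_bigr => k _.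
have kE (D : {set 'I_n}) : (inord #|D| == k) = (#|D| == k :> nat).
  by rewrite -(inj_eq val_inj) /= inordK // ltnS -[n in (_ <= n)%N]card_ord max_card.
under eq_bigl do rewrite kE.
transitivity (\sum_(D : {set 'I_n} | #|D| == k) F k).
  by apply: eq_bigr => D /eqP ->.
rewrite sumr_const -cardsE card_draws card_ord.
by rewrite /F -scaler_nat !scalerA -!natrM mulnC mulnA.
Qed.

End Recursion.

(** * The exponential series and its differential equation *)

Section Exponential.
Variable R : realType.
Local Notation A := {malg R[ctclass]}.
Variable a : completion R.

(** In degrees below N, powers in the completion are powers of a polynomial with
coefficients in the algebra, to which the formal derivative applies. *)
Lemma completionX_poly (N k m : nat) : (m < N)%N ->
  completionX a k m = ((\poly_(i < N) a i : {poly A}) ^+ k)`_m.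
Proof.
elim: k m => [|k IH] m mN; first by rewrite expr0 coef1; case: m mN.
rewrite exprS coefM /=; apply: eq_bigr => i _.
have iN : (i < N)%N by apply: leq_ltn_trans mN; rewrite -ltnS.
by rewrite coef_poly iN -IH // (leq_ltn_trans (leq_subr _ _)).
Qed.

(** The Euler derivation of a power: D (a^(k+1)) = (k+1) (D a) a^k. *)
Lemma completionX_derivation (k m : nat) :
  m.+1%:R *: completionX a k.+1 m.+1 =
  k.+1%:R *: \sum_(j < m.+1) j.+1%:R *: (a j.+1 * completionX a k (m - j)%N).
Proof.
rewrite (@completionX_poly m.+2) // !scaler_nat -coef_deriv deriv_exp coefMn /=.
congr (_ *+ _); rewrite coefM; apply: eq_bigr => j _.
rewrite coef_deriv coef_poly ltnS ltn_ord scaler_nat mulrnAl.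
by rewrite (@completionX_poly m.+2) // ltnS ltnW // ltnS leq_subr.
Qed.

Lemma completion_exp0 : a 0%N = 0 -> completion_exp a 0%N = 1.
Proof.
by move=> a0; rewrite /= big_ord_recl big_ord0 addr0 fact0 invr1 scale1r.
Qed.

(** The equation D (exp a) = (D a) (exp a), degree by degree. *)
Lemma completion_exp_recursion (m : nat) : a 0%N = 0 ->
  m.+1%:R *: completion_exp a m.+1 =
  \sum_(j < m.+1) j.+1%:R *: (a j.+1 * completion_exp a (m - j)%N).
Proof.
move=> a0; rewrite (@completion_expE _ _ _ m.+3) // big_ord_recl.
rewrite (_ : completionX a ord0 m.+1 = 0) // scaler0 add0r scaler_sumr.
transitivity (\sum_(k < m.+2) \sum_(j < m.+1)
    k`!%:R^-1 *: (j.+1%:R *: (a j.+1 * completionX a k (m - j)%N))).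
  apply: eq_bigr => k _; rewrite -scaler_sumr lift0 scalerA mulrC -scalerA.
  rewrite completionX_derivation scalerA factS natrM invfM -mulrA.
  by rewrite mulrC -mulrA mulfV ?pnatr_eq0 // mulr1.
rewrite exchange_big; apply: eq_bigr => j _.
rewrite (@completion_expE _ _ _ m.+2) //; last by rewrite ltnS ltnW // ltnS leq_subr.
rewrite mulr_sumr scaler_sumr; apply: eq_bigr => k _.
by rewrite -scalerAr !scalerA mulrC.
Qed.

(** The equation D F = (D a) F determines F_m from the F_i with i < m, because
a_0 = 0 and m is invertible. *)
Lemma completion_exp_unique (F : completion R) : a 0%N = 0 -> F 0%N = 1 ->
  (forall m, m.+1%:R *: F m.+1 =
     \sum_(j < m.+1) j.+1%:R *: (a j.+1 * F (m - j)%N)) ->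
  F = completion_exp a.
Proof.
move=> a0 F0 FS; apply/completionP => n.
have [k] := ubnP n; elim: k n => // k IH [|m] nk.
  by rewrite F0 completion_exp0.
have m_neq0 : m.+1%:R != 0 :> R by rewrite pnatr_eq0.
apply: (scalerI m_neq0); rewrite (FS m) [RHS](completion_exp_recursion m a0).
apply: eq_bigr => j _; rewrite IH //.
by apply: leq_ltn_trans (leq_subr _ _) _; rewrite -ltnS.
Qed.

End Exponential.

(** * Coefficients of the Pfaffian *)

Section Consecutive.
Variable n : nat.

Let succ_partner (i : 'I_(n.*2)) : 'I_(n.*2) := Ordinal (mate_subproof i).

Lemma succ_partnerK : involutive succ_partner.
Proof. by move=> i; apply: val_inj; rewrite /= mateK. Qed.

Lemma succ_partner_free i : succ_partner i != i.
Proof.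
rewrite -val_eqE /= /mate; case: ifP => oi; last by rewrite neq_ltn ltnSn orbT.
by case: (i : nat) oi => // k _; rewrite neq_ltn ltnSn.
Qed.

Definition consecutive : matching := Matching succ_partnerK succ_partner_free.

Lemma iso_gamma (s : 'S_(n.*2)) : iso (gamma_ s) (@mgraph consecutive s).
Proof. by exists id, id; split=> //; do ?[by exists id]; case=> i [[]|]. Qed.

End Consecutive.

Section PfaffianCoefficients.
Variable R : realType.

Lemma signed_sum_std0 : signed_sum R (std 0) = 1.
Proof.
have one (s : {perm std 0}) : s = 1%g by apply/permP => -[[]].
rewrite /signed_sum (big_pred1 1%g) => [|s]; last exact/esym/eqP/one.
rewrite /signed_term odd_perm1 expr0 scale1r; congr << _ >>.
have no_point (x : std 0) : False by case: x => -[].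
apply/ctclassP; exists (fun x : std 0 => False_rect void (no_point x)).
exists (fun u : std 0 * option bool => False_rect void (no_point u.1)).
split; do ?by case=> -[[]].
- by exists (of_void _); [case=> -[]|case].
- by exists (of_void _); [case=> -[[]]|case].
Qed.

Lemma pf_signed_sum n : pf R n = ((12 ^ n * n`!)%:R)^-1 *: signed_sum R (std n).
Proof.
rewrite /pf; case: eqP => [->|_].
  by rewrite signed_sum_std0 muln1 invr1 scale1r.
rewrite -(@signed_sum_std R (consecutive n) n (card_ord _)); congr (_ *: _).
apply: eq_bigr => s _; rewrite /signed_term; congr (_ *: << _ >>).
exact/ctclassP/iso_gamma.
Qed.

Lemma mcoeff_sum_signed_term (M : matching) (P : pred {perm M}) (x : ctclass) :
  (\sum_(s | P s) signed_term R s)@_x =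
  \sum_(s | P s && (class_of (mgraph s) == x)) (-1) ^+ s.
Proof.
rewrite raddf_sum /= big_mkcondr; apply: eq_bigr => s _.
by rewrite mcoeffZ mcoeffU1; case: eqP; rewrite ?mulr1 ?mulr0.
Qed.

Lemma mcoeff_signed_sum_conn (M : matching) (x : ctclass) :
  (signed_sum_conn R M)@_x = if connected (rep x) then (signed_sum R M)@_x else 0.
Proof.
rewrite !mcoeff_sum_signed_term.
have conn (s : {perm M}) : class_of (mgraph s) = x ->
    connected (mgraph s) = connected (rep x).
  by move=> <-; apply/esym/iso_connected/rep_class_of.
case: ifP => cx.
  by apply: eq_bigl => s; case: eqP => [/conn ->|_]; rewrite ?cx ?andbF.
by apply: big_pred0 => s; case: eqP => [/conn ->|_]; rewrite ?cx ?andbF.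
Qed.

Definition pf_coefficient (x : ctclass) : R :=
  (-1) ^+ num_even_cycles (rep x) / 6%:R ^+ degree x
  * (2%:R ^+ num_long_cycles (rep x) / #|autbar (rep x)|%:R).

(** Every class of degree n contains the graph of some permutation, to which the
double counting applies. *)
Lemma card_mgraph_class n (x : ctclass) : ctclasses n x ->
  (#|[set s : {perm std n} | class_of (mgraph s) == x]| * #|autbar (rep x)|
   = 2 ^ n * n`! * 2 ^ num_long_cycles (rep x))%N.
Proof.
move=> /ctgraph_std [s0 xs0].
rewrite (iso_autbar xs0) (iso_num_long_cycles xs0) -count_mgraph_iso; congr (_ * _)%N.
apply: eq_card => s; rewrite !inE; apply/eqP/asboolP => [sx|ss0].
  by apply: iso_trans (iso_sym (rep_class_of _)) _; rewrite sx.
rewrite -(repK x); apply/ctclassP; exact: iso_trans ss0 (iso_sym xs0).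
Qed.

Lemma card_autbar_neq0 n (x : ctclass) : ctclasses n x ->
  #|autbar (rep x)|%:R != 0 :> R.
Proof.
move=> /card_mgraph_class cx; rewrite pnatr_eq0; apply/eqP => a0.
move: cx; rewrite a0 muln0 => /esym/eqP.
by rewrite !muln_eq0 !expn_eq0 /= -leqn0 leqNgt fact_gt0.
Qed.

(** All permutations whose graph is in the class x have the same sign, and
12^n = 6^n 2^n. *)
Lemma pf_coefficientE n (x : ctclass) :
  ctclasses n x -> (pf R n)@_x = pf_coefficient x.
Proof.
move=> nx; have cx := card_mgraph_class nx; have a0 := card_autbar_neq0 nx.
rewrite pf_signed_sum mcoeffZ mcoeff_sum_signed_term /pf_coefficient.
have -> : degree x = n by rewrite /degree (nx : #|_| = _) doubleK.
rewrite (eq_bigr (fun=> (-1) ^+ num_even_cycles (rep x))) => [|s /eqP <-]; last first.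
  rewrite -(signr_odd _ (num_even_cycles _)) odd_perm_mgraph; congr (_ ^+ (odd _)).
  exact/esym/iso_num_even_cycles/rep_class_of.
rewrite sumr_const; set e := (-1) ^+ _.
have := congr1 (fun k => k%:R : R) cx; rewrite !natrM !natrX cardsE => cR.
set N := #|_| in cR *; rewrite -[_ *+ N]mulr_natr.
have -> : N%:R = 2 ^+ n * n`!%:R * 2 ^+ num_long_cycles (rep x)
                 / #|autbar (rep x)|%:R :> R.
  by rewrite -cR mulfK.
have f0 : n`!%:R != 0 :> R by rewrite pnatr_eq0 -lt0n fact_gt0.
have n2 : (2 : R) ^+ n != 0 by rewrite expf_neq0 // pnatr_eq0.
have n6 : (6 : R) ^+ n != 0 by rewrite expf_neq0 // pnatr_eq0.
rewrite (_ : 12%:R = 2 * 6 :> R) ?exprMn -?natrM //.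
move: (2 ^+ n : R) (6 ^+ n : R) (n`!%:R : R) (#|autbar (rep x)|%:R : R)
  (2 ^+ num_long_cycles (rep x) : R) (e : R) n2 n6 f0 a0.
move=> two six f a c s two_neq0 six_neq0 f_neq0 a_neq0.
by field; rewrite a_neq0 f_neq0 six_neq0 two_neq0.
Qed.

Lemma pf_coefficient_neq0 n (x : ctclass) : ctclasses n x -> pf_coefficient x != 0.
Proof.
move=> nx; rewrite /pf_coefficient.
rewrite !mulf_neq0 ?invr_neq0 ?expf_neq0 ?oppr_eq0 ?oner_eq0 ?pnatr_eq0 //.
by have := card_autbar_neq0 nx; rewrite pnatr_eq0.
Qed.

End PfaffianCoefficients.

(** * The connected part and the differential equation *)

From mathcomp Require Import finmap classical_sets cardinality fsbigop.

Section ConnectedPart.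
Variable R : realType.

Lemma mcoeff_formal_sum (P : set ctclass) (c : ctclass -> R) n (x : ctclass) :
  (formal_sum P c n)@_x = if `[< (ctclasses n `&` P)%classic x >] then c x else 0.
Proof.
have fin := finite_setIl P (finite_ctclasses n).
rewrite /= fsbig_finite //= raddf_sum /=.
under eq_bigr do rewrite mcoeffZ mcoeffU1.
case: asboolP => Px.
  have xS : x \in fset_set (ctclasses n `&` P)%classic by rewrite in_fset_set // inE.
  rewrite (bigD1_seq x) ?fset_uniq //=.
  rewrite eqxx mulr1 big1 ?addr0 // => y /negbTE ->; exact: mulr0.
rewrite big_seq big1 // => y; rewrite in_fset_set // inE => Py.
by case: eqP => [e|_]; rewrite ?mulr0 //; case: Px; rewrite -e.
Qed.

(** Restricting the signed sum to connected graphs keeps the coefficients of the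
connected classes and kills the others. *)
Lemma connected_formal_sum n :
  formal_sum ctclasses_conn (pf_coefficient R) n =
  ((12 ^ n * n`!)%:R)^-1 *: signed_sum_conn R (std n).
Proof.
apply/malgP => x; rewrite mcoeff_formal_sum mcoeffZ mcoeff_signed_sum_conn.
have := @pf_homog R n x; rewrite pf_signed_sum mcoeffZ.
have := @pf_coefficientE R n x; rewrite pf_signed_sum mcoeffZ => cE hE.
case: asboolP => [[nx cx]|nPx]; first by rewrite (cx : connected _ = true) cE.
case: ifP => cx; last by rewrite mulr0.
by apply/esym/eqP/negPn/negP => /hE nx; apply: nPx.
Qed.

Lemma signed_sum_conn_std0 : signed_sum_conn R (std 0) = 0.
Proof.
apply: big_pred0 => s; rewrite connectedE; apply/negbTE/negP.
by rewrite componentsE => /imsetP[[[]]].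
Qed.

(** The normalization by 12^n n! absorbs the binomial coefficients. *)
Lemma pf_recursion m :
  m.+1%:R *: pf R m.+1 = \sum_(j < m.+1) j.+1%:R *:
    (formal_sum ctclasses_conn (pf_coefficient R) j.+1 * pf R (m - j)%N).
Proof.
rewrite pf_signed_sum scalerA mulrC -scalerA signed_sum_recursion big_ord_recl.
rewrite mul0n scale0r add0r scaler_sumr; apply: eq_bigr => j _.
rewrite connected_formal_sum pf_signed_sum lift0 subSS.
rewrite -scalerAl -scalerAr !scalerA; congr (_ *: _).
have jm : (j <= m)%N by rewrite -ltnS.
have := @bin_fact m.+1 j.+1; rewrite ltnS subSS => /(_ jm) <-.
rewrite -{1}(subnKC jm) -addSn expnD.
have f0 k : k`!%:R != 0 :> R by rewrite pnatr_eq0 -lt0n fact_gt0.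
move: (f0 j.+1) (f0 (m - j)%N); move: (j.+1)`! (m - j)`! => f1 f2 f1_neq0 f2_neq0.
have n12 k : (12 ^ k)%:R != 0 :> R by rewrite pnatr_eq0 expn_eq0.
have b0 : 'C(m.+1, j.+1)%:R != 0 :> R by rewrite pnatr_eq0 -lt0n bin_gt0.
have := n12 j.+1; have := n12 (m - j)%N.
move: (12 ^ j.+1)%N (12 ^ (m - j))%N => p1 p2 p1_neq0 p2_neq0; rewrite !natrM.
by field; rewrite b0 f1_neq0 f2_neq0 p1_neq0 p2_neq0.
Qed.

End ConnectedPart.

Theorem lemma5p1 (R : realType) :
  (forall (n : nat) (x : ctclass), ctclasses n x -> (pf R n)@_x != 0) /\
  total_pf R =
    completion_exp (formal_sum ctclasses_conn (fun x : ctclass =>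
      (-1) ^+ num_even_cycles (rep x) / 6%:R ^+ degree x
      * (2%:R ^+ num_long_cycles (rep x) / #|autbar (rep x)|%:R))).
Proof.
split=> [n x nx|]; first by rewrite (pf_coefficientE R nx) (pf_coefficient_neq0 R nx).
apply: completion_exp_unique; last exact: pf_recursion.
  by rewrite connected_formal_sum signed_sum_conn_std0 scaler0.
by rewrite /= /pf eqxx.
Qed.
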